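(* For integers $p,q\ge2$ let $Q_{p,q}$ be the rectangular commutator grid over $\langle a,b\mid aba^{-1}b^{-1}\rangle$, and let $v$ be a corner vertex of $\partial Q_{p,q}$. Then $Q_{p,q}$ is area-minimising; in fact every edge of $Q_{p,q}$ lies on a relator face (so $Q_{p,q}$ is pure), and its boundary word is cyclically reduced. Moreover, $$\mathrm{FL}_v(Q_{p,q})=2(p+q)\quad\text{and}\quad\lambda_1(Q_{p,q})=1-\frac12\Bigl(\cos\frac{\pi}{p}+\cos\frac{\pi}{q}\Bigr).$$ Consequently there exist absolute constants $c,C>0$ such that $c(p^{-2}+q^{-2})\le\lambda_1(Q_{p,q})\le C(p^{-2}+q^{-2})$. If, in addition, $K^{-1}\le p/q\le K$, then $$c_K\,\lambda_1(Q_{p,q})^{-1/2}\le\mathrm{FL}_v(Q_{p,q})\le C_K\,\lambda_1(Q_{p,q})^{-1/2},$$ where $c_K,C_K>0$ depend only on $K$.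
   Context: $Q_{p,q}$ is the rectangular van Kampen diagram tiled by $pq$ square relator faces, with boundary word $a^pb^qa^{-p}b^{-q}$: vertices $\{0,\dots,p\}\times\{0,\dots,q\}$, horizontal unit edges labelled $a$, vertical unit edges labelled $b$, faces the unit squares. A van Kampen diagram is area-minimising if it has the minimum number of faces among van Kampen diagrams with the same boundary word; a diagram is pure if every edge is incident to at least one $2$-cell; ''minimal in the standing sense'' means area-minimising for a cyclically reduced boundary word. For a disk diagram $\Delta$ (finite, connected, simply connected planar $2$-complex) with boundary walk $\partial\Delta$ and $V^\circ=V(\Delta)\setminus V(\partial\Delta)\neq\varnothing$, $\lambda_1(\Delta)=\inf_{f\not\equiv0}\dfrac{\sum_{e\in E(\Delta)}(\widetilde f(e^+)-\widetilde f(e^-))^2}{\sum_{v\in V^\circ}\deg(v)f(v)^2}$ over $f:V^\circ\to\mathbb R$, $\widetilde f$ the extension by $0$ to $V(\partial\Delta)$. Based filling length: for $b\in V(\partial\Delta)$, a based shelling is a sequence $\Delta=\Sigma_0\supset\Sigma_1\supset\cdots\supset\Sigma_N=\{b\}$ of finite connected simply connected planar subcomplexes, each step removing a boundary $2$-cell or a boundary spur (a degree-$1$ vertex and its incident edge), with $b\in V(\partial\Sigma_j)$ for all $j$. When a boundary $2$-cell $\sigma$ meeting the current boundary in a connected arc of length $k$ is removed, that arc of the boundary walk is replaced by the complementary arc of $\partial\sigma$ (of length $|\partial\sigma|-k$), and isolated edges or vertices not containing the basepoint are deleted; if the last remaining $2$-cell has its whole boundary on the current boundary, removing it terminates the shelling.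 $\mathrm{FL}_b(\Delta)=\inf\max_{0\le j\le N}|\partial\Sigma_j|$ over based shellings, $|\partial\Sigma_j|$ being the length of the boundary walk. *)

(* Defs.v *)
From HB Require Import structures.
From mathcomp Require Import all_boot all_order all_algebra.

Set Implicit Arguments.
Unset Strict Implicit.
Unset Printing Implicit Defensive.

Import Order.TTheory GRing.Theory Num.Theory.

(* Finite 2-complexes drawn in the oriented plane, as combinatorial maps.  A
   dart is an oriented edge starting at [src d]; [dinv] reverses it; [face d]
   is the 2-cell lying to the RIGHT of [d], or [None] when the unbounded region
   lies there; [nxt d] is the dart following [d] along the boundary of that
   region.  So 2-cells are traversed clockwise and the walk along the unbounded
   region goes counterclockwise around the diagram.  Vertices form a type of
   their own so that the one-vertex diagram (without darts) is included. *)
Record complex := Complex {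
  vertex : finType;
  dart : finType;
  cell : finType;
  src : dart -> vertex;
  dinv : dart -> dart;
  nxt : dart -> dart;
  face : dart -> option cell
}.

Section Complex.
Variable D : complex.
Implicit Types (d e : dart D) (u v b : vertex D) (p : seq (dart D)).

Definition tgt d : vertex D := src (dinv d).

Definition degree v : nat := #|[set d | src d == v]|.

Definition adjacent : rel (vertex D) :=
  fun u v => [exists d, (src d == u) && (tgt d == v)].

(* A finite, connected, simply connected planar 2-complex: a connected
   combinatorial map on the sphere with the open region [None] removed.
   Regions are the cycles of [nxt], vertices the cycles of [nxt \o dinv] (the
   rotation about a vertex), and genus 0 is Euler's formula
   V - E + (F + 1) = 2, with [F] the number of 2-cells. *)
Record is_disk_diagram : Prop := IsDiskDiagram {
  disk_dinvK : involutive (@dinv D);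
  disk_dinv_neq : forall d, dinv d != d;
  disk_nxt_inj : injective (@nxt D);
  disk_src_nxt : forall d, src (nxt d) = tgt d;
  disk_rotation : forall d e,
    src d = src e <-> fconnect (fun x => nxt (dinv x)) d e;
  disk_region : forall d e, face d = face e <-> fconnect (@nxt D) d e;
  disk_cell : forall c : cell D, exists d, face d = Some c;
  disk_outer : (0 < #|dart D|)%N -> exists d, face d = None;
  disk_connected : forall u v, connect adjacent u v;
  disk_euler : (#|vertex D| + #|cell D| = #|dart D|./2 + 1)%N
}.

Definition is_pure : Prop :=
  forall d, face d <> None \/ face (dinv d) <> None.

Record subcomplex := Subcomplex {
  sV : {set vertex D};
  sE : {set dart D};
  sF : {set cell D}
}.

Implicit Types S : subcomplex.

Definition full : subcomplex := Subcomplex setT setT setT.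

Definition single_vertex b : subcomplex := Subcomplex [set b] set0 set0.

Definition is_subcomplex S : Prop :=
  [/\ forall d, d \in sE S -> dinv d \in sE S,
      forall d, d \in sE S -> src d \in sV S
    & forall d c, face d = Some c -> c \in sF S -> d \in sE S].

Fixpoint walk S u p v : bool :=
  if p is d :: p' then [&& d \in sE S, src d == u & walk S (tgt d) p' v]
  else (u == v) && (u \in sV S).

Definition is_connected S : Prop :=
  (exists u, u \in sV S) /\
  forall u v, u \in sV S -> v \in sV S -> exists p, walk S u p v.

(* Edge-path homotopy relative to the endpoints. *)
Inductive homotopic S u v : seq (dart D) -> seq (dart D) -> Prop :=
| homotopic_refl p : homotopic S u v p p
| homotopic_sym p q : homotopic S u v p q -> homotopic S u v q p
| homotopic_trans p q r :
    homotopic S u v p q -> homotopic S u v q r -> homotopic S u v p r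
| homotopic_spur p q d :
    walk S u (p ++ [:: d; dinv d] ++ q) v ->
    homotopic S u v (p ++ [:: d; dinv d] ++ q) (p ++ q)
| homotopic_cell p q d c :
    face d = Some c -> c \in sF S ->
    walk S u (p ++ orbit (@nxt D) d ++ q) v ->
    homotopic S u v (p ++ orbit (@nxt D) d ++ q) (p ++ q).

Definition simply_connected S : Prop :=
  forall u p, walk S u p u -> homotopic S u u p [::].

(* The sides of edges of [S] not covered by 2-cells of [S].  For connected,
   simply connected [S] the boundary walk runs along each of them exactly
   once. *)
Definition bd_darts S : {set dart D} :=
  [set d in sE S | if face d is Some c then c \notin sF S else true].

Definition bd_length S : nat := #|bd_darts S|.

(* The second alternative is the one-vertex complex, its own boundary. *)
Definition bd_vertices S : {set vertex D} :=
  [set v in sV S | [exists d in bd_darts S, src d == v]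
                   || ~~ [exists d in sE S, src d == v]].

Definition spur_step S S' : Prop :=
  exists d, [/\ d \in sE S,
    forall e, e \in sE S -> src e = src d -> e = d
    & S' = Subcomplex (sV S :\ src d) (sE S :\: [set d; dinv d]) (sF S)].

Definition isolated_edge (E : {set dart D}) d : bool :=
  [forall e in E, (src e \in [set src d; tgt d]) ==> (e \in [set d; dinv d])].

Definition prune b (E : {set dart D}) : {set dart D} :=
  [set d in E | ~~ (isolated_edge E d && (b \notin [set src d; tgt d]))].

(* Removal of the 2-cell [c] together with the arc [A] in which it meets the
   current boundary: the boundary cycle of [c] read from [d] is [A ++ B], all
   edges of [A] and no edges or interior vertices of [B] are on the boundary.
   Afterwards isolated edges and vertices avoiding the basepoint are deleted.
   [B] may be empty, when the whole boundary of [c] is on the current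
   boundary. *)
Definition cell_step b S S' : Prop :=
  exists c d k,
  let A := take k (orbit (@nxt D) d) in
  let B := drop k (orbit (@nxt D) d) in
  let E := prune b (sE S :\: [set e | (e \in A) || (dinv e \in A)]) in
  [/\ (c \in sF S) && (0 < k)%N, face d = Some c,
      forall e, e \in A -> dinv e \in bd_darts S,
      (forall e, e \in B -> dinv e \notin bd_darts S) /\
      (forall e, e \in behead B -> src e \notin bd_vertices S)
    & S' = Subcomplex [set v in sV S | (v == b) || [exists e in E, src e == v]]
                      E (sF S :\ c)].

Definition based_shelling b (N : nat) (Sigma : nat -> subcomplex) : Prop :=
  [/\ Sigma 0 = full, Sigma N = single_vertex b,
      forall j, (j <= N)%N ->
        [/\ is_subcomplex (Sigma j), is_connected (Sigma j),
            simply_connected (Sigma j) & b \in bd_vertices (Sigma j)]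
    & forall j, (j < N)%N ->
        spur_step (Sigma j) (Sigma j.+1) \/
        cell_step b (Sigma j) (Sigma j.+1)].

End Complex.

Section Words.
Variable X : eqType.

(* [(x, true)] is the generator [x] and [(x, false)] its inverse. *)
Definition letter : eqType := (X * bool)%type.

Definition linv (l : letter) : letter := (l.1, ~~ l.2).

Definition winv (w : seq letter) : seq letter := rev (map linv w).

Definition cyclically_reduced (w : seq letter) : bool :=
  cycle (fun l m => m != linv l) w.

Record diagram := Diagram {
  carrier :> complex;
  label : dart carrier -> letter
}.

Definition walk_word (D : diagram) (d : dart D) : seq letter :=
  map (@label D) (orbit (@nxt D) d).

Record is_van_kampen (rels : seq (seq letter)) (D : diagram) : Prop :=
  IsVanKampen {
    vk_disk : is_disk_diagram D;
    vk_label : forall d : dart D, label (dinv d) = linv (label d);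
    vk_relator : forall c : cell D, exists d : dart D, face d = Some c /\
      (walk_word d \in rels \/ winv (walk_word d) \in rels)
  }.

Definition is_boundary_word (D : diagram) (w : seq letter) : Prop :=
  (exists d : dart D, face d = None /\ w = walk_word d) \/
  (#|dart D| = 0%N /\ w = [::]).

Definition area (D : diagram) : nat := #|cell D|.

Definition area_minimising (rels : seq (seq letter)) (D : diagram) : Prop :=
  is_van_kampen rels D /\
  forall (D' : diagram) (w : seq letter),
    is_van_kampen rels D' -> is_boundary_word D w -> is_boundary_word D' w ->
    (area D <= area D')%N.

End Words.

From mathcomp Require Import reals exp trigo.

Section Invariants.
Variable R : realType.
Local Open Scope ring_scope.

(* [inf] is 0 on the empty set, so a positive value of [FL] entails that a
   based shelling exists. *)
Definition FL (D : complex) (b : vertex D) : R :=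
  inf (fun x : R => exists (N : nat) (Sigma : nat -> subcomplex D),
         based_shelling b N Sigma /\
         x = (\max_(j < N.+1) bd_length (Sigma j))%N%:R).

(* [f] is already extended by 0 to the boundary vertices.  Summing over darts
   counts every edge twice. *)
Definition rayleigh (D : complex) (f : vertex D -> R) : R :=
  (2^-1 * \sum_(d : dart D) (f (tgt d) - f (src d)) ^+ 2) /
  (\sum_(v | v \notin bd_vertices (full D)) (degree v)%:R * f v ^+ 2).

Definition lambda1 (D : complex) : R :=
  inf (fun x : R => exists f : vertex D -> R,
         [/\ forall v, v \in bd_vertices (full D) -> f v = 0,
             exists v, f v != 0 & x = rayleigh f]).

End Invariants.

Inductive gen := gen_a | gen_b.

Definition bool_of_gen g := if g is gen_a then true else false.
Definition gen_of_bool (x : bool) := if x then gen_a else gen_b.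

Lemma bool_of_genK : cancel bool_of_gen gen_of_bool.
Proof. by case. Qed.

HB.instance Definition _ := Equality.copy gen (can_type bool_of_genK).

Definition la : letter gen := (gen_a, true).
Definition lb : letter gen := (gen_b, true).

Definition commutator_relators : seq (seq (letter gen)) :=
  [:: [:: la; lb; linv la; linv lb]].

Definition commutator_word (p q : nat) : seq (letter gen) :=
  nseq p la ++ nseq q lb ++ nseq p (linv la) ++ nseq q (linv lb).

Section Grid.
Variables p q : nat.

Definition gvertex : finType := ('I_p.+1 * 'I_q.+1)%type.

(* [inl (x, y)] is the edge from (x, y) to (x+1, y) and [inr (x, y)] the edge
   from (x, y) to (x, y+1); the boolean is [true] for these orientations. *)
Definition gedge : finType := (('I_p * 'I_q.+1) + ('I_p.+1 * 'I_q))%type.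
Definition gdart : finType := (gedge * bool)%type.

(* The unit square with lower left corner (x, y). *)
Definition gcell : finType := ('I_p * 'I_q)%type.

Definition gend (e : gedge) (far : bool) : gvertex :=
  match e with
  | inl (x, y) => (if far then lift ord0 x else widen_ord (leqnSn p) x, y)
  | inr (x, y) => (x, if far then lift ord0 y else widen_ord (leqnSn q) y)
  end.

Definition gsrc (d : gdart) : gvertex := gend d.1 (~~ d.2).
Definition gdinv (d : gdart) : gdart := (d.1, ~~ d.2).

Definition gpair (m n x y : nat) : option ('I_m * 'I_n) :=
  if (insub x, insub y) is (Some i, Some j) then Some (i, j) else None.

Definition hdart (x y : nat) (o : bool) : option gdart :=
  omap (fun e => (inl e, o)) (gpair p q.+1 x y).
Definition vdart (x y : nat) (o : bool) : option gdart :=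
  omap (fun e => (inr e, o)) (gpair p.+1 q x y).

(* The region to the right of a dart. *)
Definition gface (d : gdart) : option gcell :=
  match d with
  | (inl (x, y), true) => if nat_of_ord y is y'.+1 then gpair p q x y' else None
  | (inl (x, y), false) => gpair p q x y
  | (inr (x, y), true) => gpair p q x y
  | (inr (x, y), false) => if nat_of_ord x is x'.+1 then gpair p q x' y else None
  end.

(* Directions 0, 1, 2, 3 (mod 4) are east, north, west, south. *)
Definition gdir (d : gdart) : nat :=
  match d with
  | (inl _, true) => 0
  | (inr _, true) => 1
  | (inl _, false) => 2
  | (inr _, false) => 3
  end.

(* The dart leaving vertex [u] in direction [t], if there is one. *)
Definition gout (u : gvertex) (t : nat) : option gdart :=
  let x := nat_of_ord u.1 in
  let y := nat_of_ord u.2 in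
  match t %% 4 with
  | 0 => hdart x y true
  | 1 => vdart x y true
  | 2 => if x is x'.+1 then hdart x' y false else None
  | _ => if y is y'.+1 then vdart x y' false else None
  end.

(* Keeping the region on the right: turn right if possible, else go straight
   on, else turn left, else turn back. *)
Definition gnxt (d : gdart) : gdart :=
  let u := gsrc (gdinv d) in
  let t := gdir d in
  if gout u (t + 3) is Some e then e
  else if gout u t is Some e then e
  else if gout u (t + 1) is Some e then e
  else gdinv d.

Definition glabel (d : gdart) : letter gen :=
  (if d.1 is inl _ then gen_a else gen_b, d.2).

Definition grid_complex : complex :=
  @Complex gvertex gdart gcell gsrc gdinv gnxt gface.

Definition grid : diagram gen := @Diagram gen grid_complex glabel.

Definition grid_corner (v : vertex grid) : bool :=
  ((v.1 == ord0) || (v.1 == ord_max)) && ((v.2 == ord0) || (v.2 == ord_max)).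

End Grid.

(* Main.v *)
From mathcomp Require Import all_boot all_order all_algebra.
From mathcomp Require Import zify ring lra.
From mathcomp Require Import reals topology normedtype derive exp trigo.
Require Import Defs.

Set Implicit Arguments.
Unset Strict Implicit.
Unset Printing Implicit Defensive.

Import Order.TTheory GRing.Theory Num.Theory.
Import numFieldNormedType.Exports.

(** The area is bounded below by a winding argument. In a van Kampen diagram
    over [aba^-1b^-1] the exponent of [b] is a cochain that sums to zero around
    every cell; a disk diagram has no first cohomology ([exact_cochain], a rank
    count with Euler's formula), so this cochain is the increment of a height
    function on the vertices. The height and the exponent of [a] develop the
    diagram in the plane, where every cell has signed area one or minus one. The
    integral of [y dx] along the boundary depends on the boundary word only and
    is [pq] in absolute value for [a^p b^q a^-p b^-q], whence at least [pq] cells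
    ([area_ge_rectangle]).

    The filling length is at least the initial boundary length [2(p+q)]. It is
    attained by removing the squares row by row from the top, in each row from
    the far end towards the base corner: a removed square has at least two of its
    sides, consecutive ones, on the current boundary, so the boundary never gets
    longer ([staircase_cell_step]). The intermediate complexes are staircases.
    They are connected and simply connected because the paths going first west,
    then south to the corner form a combing ([combing_simply_connected],
    [home_along]). Only the lower left corner is treated in this way; quarter
    turns of the plane carry it to the other three ([shellable_turn]).

    The Dirichlet energy of the grid is the sum of the energies of its rows and
    columns, which are paths with Dirichlet ends. On a path with [n] edges,
    Jacobi's identity against the positive function [sin (pi x / n)] shows that
    the energy is at least [2(1 - cos (pi / n))] times the mass, with equality
    for that function ([jacobi_identity]). Interior vertices have degree four, so
    adding both directions gives the bound on the Rayleigh quotient, attained by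
    the product of two sines ([lambda1_grid]). The asymptotic statements follow
    from comparing [1 - cos t] with [t^2] on the first quadrant. *)

(** * Regions, walks and homotopies in a drawn complex *)

(** To recognise the orbits of a map it is enough to write down, for each value
    of an invariant, one cycle that fills the fibre. The regions of the grid and
    the stars of its vertices are identified in this way. *)
Lemma fconnect_fibres (T : finType) (K : eqType) (f : T -> T) (key : T -> K)
    (cyc : K -> seq T) :
    (forall k, uniq (cyc k)) -> (forall k, fcycle f (cyc k)) ->
    (forall k x, (x \in cyc k) = (key x == k)) ->
  injective f /\ forall x y, key x = key y <-> fconnect f x y.
Proof.
move=> cycU cycF cycE.
have mem_cyc x : x \in cyc (key x) by rewrite cycE.
have fE x : f x = next (cyc (key x)) x.
  by apply/eqP; apply: (next_cycle (cycF _)) (mem_cyc x).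
have keyf x : key (f x) = key x.
  by apply/eqP; rewrite -cycE fE mem_next mem_cyc.
split=> [x y fxy | x y].
  have kxy : key x = key y by rewrite -(keyf x) fxy keyf.
  by move: fxy; rewrite !fE kxy; apply: (can_inj (prev_next (cycU _))).
rewrite (fconnect_cycle (cycF _) (mem_cyc x)) cycE eq_sym.
by split => [->|/eqP].
Qed.

Section Homotopy.
Variable D : complex.
Hypothesis diskD : is_disk_diagram D.
Implicit Types (S : subcomplex D) (d e : dart D) (u v w : vertex D).
Implicit Types (p q r : seq (dart D)).

Let dinvK := disk_dinvK diskD.

Lemma tgt_dinv d : tgt (dinv d) = src d.
Proof. by rewrite /tgt dinvK. Qed.

Lemma src_dinv d : src (dinv d) = tgt d.
Proof. by []. Qed.

Lemma face_nxt d : face (nxt d) = face d.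
Proof. by apply/esym/(disk_region diskD)/fconnect1. Qed.

Lemma mem_orbit_nxt d e : (e \in orbit (@nxt D) d) = (face e == face d).
Proof.
rewrite -fconnect_orbit; apply/idP/eqP => [|fde].
  by move/(disk_region diskD).
exact/(disk_region diskD).
Qed.

Section Walks.
Variable S : subcomplex D.
Hypothesis subS : is_subcomplex S.

Let dinvS d : d \in sE S -> dinv d \in sE S. Proof. by case: subS => + _ _; apply. Qed.
Let srcS d : d \in sE S -> src d \in sV S. Proof. by case: subS => _ + _; apply. Qed.
Let tgtS d : d \in sE S -> tgt d \in sV S. Proof. by move=> /dinvS /srcS. Qed.

Lemma walk_src u p v : walk S u p v -> u \in sV S.
Proof. by case: p => [|d p] /= => [/andP[_] | /and3P[/srcS + /eqP<-]]. Qed.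

Lemma walk_cat u w v p q : walk S u p w -> walk S w q v -> walk S u (p ++ q) v.
Proof.
elim: p u => [|d p IHp] u /=; first by case/andP=> /eqP->.
by case/and3P=> -> -> /IHp; apply.
Qed.

Lemma walk_dart d : d \in sE S -> walk S (src d) [:: d] (tgt d).
Proof. by move=> dS /=; rewrite dS !eqxx tgtS. Qed.

Lemma walk_cons d p v : d \in sE S -> walk S (tgt d) p v -> walk S (src d) (d :: p) v.
Proof. by move=> /= -> ->; rewrite eqxx. Qed.

Lemma walk_dart_rev d : d \in sE S -> walk S (tgt d) [:: dinv d] (src d).
Proof. by move=> /dinvS/walk_dart; rewrite tgt_dinv. Qed.

Definition rev_walk p := rev (map (@dinv D) p).

Lemma walk_rev u v p : walk S u p v -> walk S v (rev_walk p) u.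
Proof.
rewrite /rev_walk; elim: p u => [|d p IHp] u /=.
  by case/andP=> /eqP-> ->; rewrite eqxx.
case/and3P=> dS /eqP <- /IHp pv; rewrite rev_cons -cats1.
exact: walk_cat pv (walk_dart_rev dS).
Qed.

Lemma homotopic_catl u w v r p q :
  walk S u r w -> homotopic S w v p q -> homotopic S u v (r ++ p) (r ++ q).
Proof.
move=> ur; elim=> {p q} [p | p q _ | p q s _ pq _ | p q d pq | p q d c dc cF pq].
- exact: homotopic_refl.
- exact: homotopic_sym.
- exact: homotopic_trans.
- by rewrite !(catA r p); apply: homotopic_spur; rewrite -!(catA r p); apply: walk_cat pq.
- rewrite !(catA r p); apply: homotopic_cell dc cF _.
  by rewrite -!(catA r p); apply: walk_cat pq.
Qed.

Lemma homotopic_catr u w v r p q :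
  walk S w r v -> homotopic S u w p q -> homotopic S u v (p ++ r) (q ++ r).
Proof.
move=> rv; elim=> {p q} [p | p q _ | p q s _ pq _ | p q d pq | p q d c dc cF pq].
- exact: homotopic_refl.
- exact: homotopic_sym.
- exact: homotopic_trans.
- rewrite -!catA; apply: homotopic_spur.
  by have := walk_cat pq rv; rewrite -!catA.
- rewrite -!catA; apply: homotopic_cell dc cF _.
  by have := walk_cat pq rv; rewrite -!catA.
Qed.

Lemma homotopic_cons v d p q :
    d \in sE S -> homotopic S (tgt d) v p q ->
  homotopic S (src d) v (d :: p) (d :: q).
Proof. by move=> /walk_dart; apply: (@homotopic_catl _ _ v [:: d]). Qed.

Lemma homotopic_spur_head v d p :
    d \in sE S -> walk S (src d) p v ->
  homotopic S (src d) v [:: d, dinv d & p] p.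
Proof.
move=> dS pv; apply: (@homotopic_spur _ S (src d) v [::] p d) => /=.
by rewrite dS dinvS // src_dinv tgt_dinv !eqxx.
Qed.

Lemma homotopic_rev u v p :
  walk S u p v -> homotopic S u u (p ++ rev_walk p) [::].
Proof.
rewrite /rev_walk; elim: p u => [|d p IHp] u /=; first by move=> _; apply: homotopic_refl.
case/and3P=> dS /eqP <- pv; rewrite rev_cons -cats1 catA.
apply: (@homotopic_trans _ _ _ _ _ [:: d; dinv d]).
  apply: (homotopic_cons dS).
  exact: (homotopic_catr (walk_dart_rev dS) (IHp _ pv)).
apply: homotopic_spur_head => //=.
by rewrite eqxx srcS.
Qed.

(** Cancelling the last two sides of a square against spurs turns the relation
    given by its boundary loop into an exchange of two adjacent sides. *)
Lemma homotopic_square c d1 d2 d3 d4 :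
    face d1 = Some c -> c \in sF S -> orbit (@nxt D) d1 = [:: d1; d2; d3; d4] ->
  homotopic S (src d1) (src d3) [:: d1; d2] [:: dinv d4; dinv d3].
Proof.
move=> fd1 cF orb.
have nxtI := disk_nxt_inj diskD; have srcN := disk_src_nxt diskD.
have /= := cycle_orbit nxtI d1; rewrite orb /= andbT => /and4P[].
move=> /eqP n1 /eqP n2 /eqP n3 /eqP n4.
have inE e : e \in [:: d1; d2; d3; d4] -> e \in sE S.
  by case: subS => _ _ fS; rewrite -orb mem_orbit_nxt => /eqP fe; apply: (fS _ c) => //; rewrite fe.
have [d1S d2S d3S d4S] : [/\ d1 \in sE S, d2 \in sE S, d3 \in sE S & d4 \in sE S].
  by split; apply: inE; rewrite !inE eqxx ?orbT.
have t1 : tgt d1 = src d2 by rewrite -n1 srcN.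
have t2 : tgt d2 = src d3 by rewrite -n2 srcN.
have t3 : tgt d3 = src d4 by rewrite -n3 srcN.
have t4 : tgt d4 = src d1 by rewrite -n4 srcN.
have w34 : walk S (src d3) [:: d3; d4] (src d1).
  by rewrite /= d3S d4S t3 t4 !eqxx srcS.
have w12 : walk S (src d1) [:: d1; d2] (src d3).
  by rewrite /= d1S d2S t1 t2 !eqxx srcS.
have wr : walk S (src d1) [:: dinv d4; dinv d3] (src d3) by apply: (walk_rev w34).
apply: (@homotopic_trans _ _ _ _ _ [:: d1; d2; d3; d4; dinv d4; dinv d3]).
  apply: homotopic_sym.
  by have := homotopic_catl w12 (homotopic_rev w34); apply.
have := @homotopic_cell _ S (src d1) (src d3) [::] [:: dinv d4; dinv d3] d1 c fd1 cF.
by rewrite orb; apply; apply: (walk_cat (walk_cat w12 w34) wr).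
Qed.

(** Combing: if every vertex has a chosen path to a base point, compatible up to
    homotopy with the passage along each edge, then every walk is homotopic to
    the difference of the chosen paths of its ends. *)
Section Combing.
Variables (b : vertex D) (comb : vertex D -> seq (dart D)).
Hypothesis bS : b \in sV S.
Hypothesis comb_walk : forall u, u \in sV S -> walk S u (comb u) b.

Definition comb_along d :=
  homotopic S (src d) b (d :: comb (tgt d)) (comb (src d)).

Lemma comb_along_dinv d : d \in sE S -> comb_along d -> comb_along (dinv d).
Proof.
move=> dS comb_d; rewrite /comb_along tgt_dinv src_dinv.
have -> : tgt d = src (dinv d) by [].
have := homotopic_cons (dinvS dS) (q := d :: comb (tgt d)) (p := comb (src d)) (v := b).
rewrite tgt_dinv => /(_ (homotopic_sym comb_d)) /homotopic_trans; apply.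
have := @homotopic_spur_head b (dinv d) (comb (tgt d)) (dinvS dS); rewrite dinvK; apply.
by rewrite src_dinv; apply: comb_walk; apply: tgtS.
Qed.

Hypothesis combP : forall d, d \in sE S -> comb_along d.

Lemma combing_connected : is_connected S.
Proof.
split; first by exists b.
move=> u v uS vS; exists (comb u ++ rev_walk (comb v)).
by apply: walk_cat (comb_walk uS) (walk_rev (comb_walk vS)).
Qed.

Lemma combing_simply_connected : simply_connected S.
Proof.
have combw p u v : walk S u p v -> homotopic S u b (p ++ comb v) (comb u).
  elim: p u => [|d p IHp] u /=; first by case/andP=> /eqP-> _; apply: homotopic_refl.
  case/and3P=> dS /eqP <- /IHp pv; apply: homotopic_trans (combP dS).
  exact: homotopic_cons.
move=> u p upu; have uS := walk_src upu; have wu := comb_walk uS.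
apply: (@homotopic_trans _ _ _ _ _ ((p ++ comb u) ++ rev_walk (comb u))).
  rewrite -catA -{1}[p]cats0; apply: (homotopic_catl upu).
  by apply: homotopic_sym; apply: homotopic_rev wu.
apply: homotopic_trans (homotopic_rev wu).
exact: (homotopic_catr (walk_rev wu) (combw _ _ _ upu)).
Qed.

End Combing.
End Walks.

Definition cell_in (F : {set cell D}) (r : option (cell D)) :=
  if r is Some c then c \in F else false.

Definition hull_darts (F : {set cell D}) : {set dart D} :=
  [set d | cell_in F (face d) || cell_in F (face (dinv d))].

(** Adding the base point separately makes the last stage of a shelling, where
    [F] is empty, the one-vertex complex. *)
Definition hull b (F : {set cell D}) : subcomplex D :=
  Subcomplex [set v | (v == b) || [exists d in hull_darts F, src d == v]]
             (hull_darts F) F.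

Lemma hull_subcomplex b F : is_subcomplex (hull b F).
Proof.
split=> [d | d dF | d c fd cF] /=; rewrite ?inE ?dinvK.
- by rewrite orbC.
- by apply/orP; right; apply/existsP; exists d; rewrite dF eqxx.
- by rewrite fd /= cF.
Qed.

Lemma bd_darts_hull b F d :
  (d \in bd_darts (hull b F)) = cell_in F (face (dinv d)) && ~~ cell_in F (face d).
Proof.
rewrite !inE; case: (face d) => [c|] /=; last by rewrite andbT.
by case: (c \in F); rewrite ?andbF ?andbT.
Qed.

Lemma cell_inD1 F c (r : option (cell D)) : cell_in (F :\ c) r = (r != Some c) && cell_in F r.
Proof. by case: r => [c'|] //=; rewrite !inE. Qed.

Section HullStep.
Variables (b : vertex D) (F : {set cell D}) (c : cell D) (d : dart D) (k : nat).
Let A := take k (orbit (@nxt D) d).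
Let B := drop k (orbit (@nxt D) d).
Hypotheses (cF : c \in F) (fd : face d = Some c).
Hypothesis A_free : forall e, e \in A -> ~~ cell_in F (face (dinv e)).
Hypothesis B_covered : forall e, e \in B -> cell_in (F :\ c) (face (dinv e)).

Let faceAB e : e \in A ++ B -> face e = Some c.
Proof. by rewrite cat_take_drop mem_orbit_nxt fd => /eqP. Qed.

Let faceA e : e \in A -> face e = Some c.
Proof. by move=> eA; apply: faceAB; rewrite mem_cat eA. Qed.

Let faceB e : e \in B -> face e = Some c.
Proof. by move=> eB; apply: faceAB; rewrite mem_cat eB orbT. Qed.

Let c_sides e : face e = Some c -> (e \in A) || (e \in B).
Proof. by rewrite -mem_cat cat_take_drop mem_orbit_nxt fd => ->. Qed.

(** When the sides in [A] of the cell [c] face no cell of [F] and the sides in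
    [B] face other cells of [F], every side of a remaining cell survives the
    removal of [A]: pruning deletes nothing, because the next side of a remaining
    cell keeps an edge from being isolated. *)
Lemma hull_cell_step :
    (0 < k)%N ->
    (forall e, e \in behead B -> forall e', src e' = src e -> cell_in F (face e')) ->
    (forall e, face e != None -> (nxt e != e) && (nxt e != dinv e)) ->
  cell_step b (hull b F) (hull b (F :\ c)).
Proof.
move=> k_gt0 B_inner nondeg; exists c, d, k => /=; rewrite -/A -/B.
have darts_eq : hull_darts (F :\ c) =
    prune b (hull_darts F :\: [set e | (e \in A) || (dinv e \in A)]).
  set E := hull_darts F :\: _.
  have notA e : cell_in (F :\ c) (face e) -> (e \notin A) && (dinv e \notin A).
    rewrite cell_inD1 => /andP[fe feF]; apply/andP; split.
      by apply: contra fe => /faceA ->.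
    by apply: contraL feF => /A_free; rewrite dinvK.
  have inE' e : cell_in (F :\ c) (face e) -> (e \in E) && (dinv e \in E).
    move=> fe; have [eA deA] := andP (notA e fe).
    rewrite !inE dinvK (negPf eA) (negPf deA) /=.
    by move: fe; rewrite cell_inD1 => /andP[_ ->]; rewrite orbT.
  have not_isolated e : cell_in (F :\ c) (face e) -> ~~ isolated_edge E e.
    move=> fe; apply/forallPn; exists (nxt e); rewrite !inE.
    have /inE'/andP[+ _] : cell_in (F :\ c) (face (nxt e)) by rewrite face_nxt.
    rewrite !inE => -> /=; rewrite (disk_src_nxt diskD) eqxx orbT /=.
    have /nondeg/andP[/negPf-> /negPf->] : face e != None by case: (face e) fe.
    by [].
  apply/setP=> e; rewrite [in RHS]inE; apply/idP/idP.
    rewrite inE => /orP[] fe.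
      by have /andP[-> _] := inE' _ fe; rewrite (negPf (not_isolated _ fe)).
    have /andP[_] := inE' _ fe; rewrite dinvK => -> /=.
    rewrite negb_and; apply/orP; left; apply: contra (not_isolated _ fe).
    move=> /forallP iso; apply/forallP=> e'; have := iso e'.
    by rewrite !inE tgt_dinv dinvK src_dinv ![(_ == src e) || _]orbC ![(_ == e) || _]orbC.
  case/andP => + _; rewrite !inE => /andP[/norP[eA deA]].
  have side e1 : e1 \notin A -> cell_in F (face e1) ->
      cell_in (F :\ c) (face e1) || cell_in (F :\ c) (face (dinv e1)).
    move=> e1A fe1; rewrite cell_inD1 fe1 andbT.
    have [fe1c|] //= := eqVneq; have := c_sides fe1c.
    by rewrite (negPf e1A) /= => /B_covered.
  by case/orP=> [/(side _ eA)//|/(side _ deA)]; rewrite dinvK orbC.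
split=> //; first by rewrite cF k_gt0.
- move=> e eA; rewrite bd_darts_hull dinvK (faceA eA) /= cF /=.
  exact: A_free.
- split=> e eB.
    rewrite bd_darts_hull negb_and; apply/orP; right; rewrite negbK.
    by move: (B_covered eB); rewrite cell_inD1 => /andP[].
  have eB' : e \in B by apply: mem_behead.
  apply/negP => /setIdP[_ /orP[/existsP[e' /andP[]]|/existsP[]]].
    by rewrite bd_darts_hull => /andP[_ fe'] /eqP /(B_inner e eB); apply/negP.
  by exists e; rewrite eqxx inE (faceB eB') /= cF.
- rewrite -darts_eq; congr Subcomplex; apply/setP=> v; rewrite !inE.
  have [//|_] /= := eqVneq v b; apply/idP/andP => [|[]//] ex; split=> //.
  case/existsP: ex => e /andP[eF /eqP <-]; apply/existsP; exists e; rewrite eqxx andbT.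
  move: eF; rewrite !inE !cell_inD1.
  by case/orP=> /andP[_ ->]; rewrite ?orbT.
Qed.

(** The sides in [A] leave the boundary, and only sides in [B] can enter it. *)
Lemma bd_length_hull_step :
  (bd_length (hull b (F :\ c)) + size A <= bd_length (hull b F) + size B)%N.
Proof.
have dinv_inj := inv_inj dinvK.
have AU : uniq A by apply/take_uniq/orbit_uniq.
have BU : uniq B by apply/drop_uniq/orbit_uniq.
pose dA := [set e | dinv e \in A].
have cardA : #|dA| = size A.
  rewrite -(card_uniqP AU) -(card_imset _ dinv_inj); apply: eq_card => e.
  apply/imsetP/idP => [[e' + ->]|eA]; first by rewrite inE.
  by exists (dinv e); rewrite ?inE dinvK.
have cardB : #|[set e | e \in B]| = size B by rewrite cardsE; apply/card_uniqP.
have dA_bd : dA \subset bd_darts (hull b F).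
  apply/subsetP=> e; rewrite inE => eA; rewrite bd_darts_hull (faceA eA) /= cF /=.
  by have := A_free eA; rewrite dinvK.
rewrite -cardA -cardB /bd_length -(cardsID dA (bd_darts (hull b F))).
rewrite (setIidPr dA_bd) -addnA addnC leq_add2l.
apply: leq_trans (leq_card_setU _ _); apply/subset_leq_card/subsetP => e.
rewrite bd_darts_hull !cell_inD1 => /andP[/andP[fdc fdF] fe].
rewrite !inE fdF /=; case: (boolP (dinv e \in A)) => [/faceA|deA].
  by move: fdc => /eqP.
move: fe; rewrite negb_and negbK => /orP[/eqP fe|].
  have := c_sides fe; case/orP=> [eA|->]; last by rewrite orbT.
  by have := A_free eA; rewrite fdF.
by rewrite orbT /=; case: (face e) => //= c' ->; rewrite ?andbT.
Qed.

End HullStep.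
End Homotopy.

(** * Isomorphic complexes have corresponding shellings *)

(** Preserving [nxt] excludes reflections; in exchange the boundary loops of cells
    correspond without reversal, so that every notion below is transported
    literally. *)
Record complex_iso (D D' : complex) := ComplexIso {
  iso_v : vertex D -> vertex D';
  iso_d : dart D -> dart D';
  iso_c : cell D -> cell D';
  iso_v_bij : bijective iso_v;
  iso_d_bij : bijective iso_d;
  iso_c_bij : bijective iso_c;
  iso_src : forall d, src (iso_d d) = iso_v (src d);
  iso_dinv : forall d, dinv (iso_d d) = iso_d (dinv d);
  iso_nxt : forall d, nxt (iso_d d) = iso_d (nxt d);
  iso_face : forall d, face (iso_d d) = omap iso_c (face d)
}.

Section Transport.
Variables (D D' : complex) (phi : complex_iso D D').
Hypothesis diskD : is_disk_diagram D.
Let fv := iso_v phi.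
Let fd := iso_d phi.
Let fc := iso_c phi.
Let fvI : injective fv := bij_inj (iso_v_bij phi).
Let fdI : injective fd := bij_inj (iso_d_bij phi).
Let fcI : injective fc := bij_inj (iso_c_bij phi).

Let fv_surj v' : exists v, v' = fv v.
Proof. by have [g _ K] := iso_v_bij phi; exists (g v'); rewrite /fv K. Qed.
Let fd_surj d' : exists d, d' = fd d.
Proof. by have [g _ K] := iso_d_bij phi; exists (g d'); rewrite /fd K. Qed.
Let fc_surj c' : exists c, c' = fc c.
Proof. by have [g _ K] := iso_c_bij phi; exists (g c'); rewrite /fc K. Qed.
Let map_surj p' : exists p, p' = map fd p.
Proof.
have [g _ K] := iso_d_bij phi; exists (map g p').
by rewrite -map_comp map_id_in // => d _ /=; rewrite /fd K.
Qed.

Let srcE d : src (fd d) = fv (src d). Proof. exact: iso_src. Qed.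
Let dinvE d : dinv (fd d) = fd (dinv d). Proof. exact: iso_dinv. Qed.
Let tgtE d : tgt (fd d) = fv (tgt d). Proof. by rewrite /tgt dinvE srcE. Qed.

Lemma iso_orbit d : orbit (@nxt D') (fd d) = map fd (orbit (@nxt D) d).
Proof.
have nxtI := disk_nxt_inj diskD.
have cyc : fcycle (@nxt D') (map fd (orbit (@nxt D) d)).
  have := cycle_orbit nxtI d; case: (orbit _ d) => //= e s.
  rewrite -map_rcons path_map; apply: sub_path => x y /= /eqP <-.
  by apply/eqP; exact: iso_nxt.
rewrite (orbitE cyc) ?map_f ?in_orbit //; last by rewrite map_inj_uniq ?orbit_uniq.
rewrite index_map // {1}/orbit -orderSpred /=.
by rewrite eqxx rot0.
Qed.

Definition iso_sub (S : subcomplex D) : subcomplex D' :=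
  Subcomplex (fv @: sV S) (fd @: sE S) (fc @: sF S).

Let bd_dartsE S d : (fd d \in bd_darts (iso_sub S)) = (d \in bd_darts S).
Proof.
rewrite !inE mem_imset // /fd iso_face; case: (face d) => [c|] //=.
by rewrite mem_imset.
Qed.

Let some_dart (P : pred (dart D)) (Q : pred (dart D')) :
  (forall d, Q (fd d) = P d) -> [exists d, Q d] = [exists d, P d].
Proof.
move=> PQ; apply/existsP/existsP => -[d]; last by rewrite -PQ; exists (fd d).
by have [e ->] := fd_surj d; rewrite PQ; exists e.
Qed.

Let bd_verticesE S v : (fv v \in bd_vertices (iso_sub S)) = (v \in bd_vertices S).
Proof.
rewrite !inE mem_imset //.
rewrite (some_dart (P := fun d => (d \in bd_darts S) && (src d == v))); last first.
  by move=> d; rewrite bd_dartsE srcE (inj_eq fvI).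
rewrite (some_dart (P := fun d => (d \in sE S) && (src d == v))) //.
by move=> d; rewrite mem_imset // srcE (inj_eq fvI).
Qed.

Lemma iso_bd_length S : bd_length (iso_sub S) = bd_length S.
Proof.
rewrite /bd_length -(card_imset _ fdI); apply: eq_card => d'.
have [d ->] := fd_surj d'.
by rewrite bd_dartsE mem_imset.
Qed.

Let walkE S u p v : walk (iso_sub S) (fv u) (map fd p) (fv v) = walk S u p v.
Proof.
elim: p u => [|d p IHp] u /=; first by rewrite (inj_eq fvI) mem_imset.
by rewrite mem_imset // srcE (inj_eq fvI) tgtE IHp.
Qed.

Let homotopicE S u v p q :
  homotopic S u v p q -> homotopic (iso_sub S) (fv u) (fv v) (map fd p) (map fd q).
Proof.
elim=> {p q} [p | p q _ | p q s _ pq _ | p q d pq | p q d c dc cF pq].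
- exact: homotopic_refl.
- exact: homotopic_sym.
- exact: homotopic_trans.
- rewrite !map_cat /= -dinvE; apply: homotopic_spur.
  by rewrite -walkE !map_cat /= -dinvE in pq.
- rewrite !map_cat -iso_orbit; apply: (@homotopic_cell _ _ _ _ _ _ _ (fc c)).
  + by rewrite /fd iso_face dc.
  + by rewrite mem_imset.
  + by rewrite iso_orbit -!map_cat walkE.
Qed.

Lemma iso_subcomplex S : is_subcomplex S -> is_subcomplex (iso_sub S).
Proof.
case=> dS sS fS; split=> [d'|d'|d' c'] /=; have [d ->] := fd_surj d'.
- by rewrite dinvE !mem_imset //; apply: dS.
- by rewrite srcE !mem_imset //; apply: sS.
have [c ->] := fc_surj c'; rewrite /fd iso_face !mem_imset //.
by case fdc: (face d) => [c1|] //= [/fcI c1c]; apply: fS; rewrite fdc c1c.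
Qed.

Lemma iso_connected S : is_connected S -> is_connected (iso_sub S).
Proof.
case=> -[u uS] conS; split; first by exists (fv u); rewrite /= mem_imset.
move=> u' v'; have [x ->] := fv_surj u'; have [y ->] := fv_surj v' => /=.
rewrite !mem_imset // => xS yS; have [p xpy] := conS _ _ xS yS.
by exists (map fd p); rewrite walkE.
Qed.

Lemma iso_simply_connected S : simply_connected S -> simply_connected (iso_sub S).
Proof.
move=> scS u' p'; have [u ->] := fv_surj u'; have [p ->] := map_surj p'.
by rewrite walkE => /scS/homotopicE.
Qed.

Let iso_sub_eq (S T : subcomplex D') : sV S =i sV T -> sE S =i sE T -> sF S =i sF T -> S = T.
Proof. by case: S T => [? ? ?] [? ? ?] /= /setP-> /setP-> /setP->. Qed.

Lemma iso_spur_step S T : spur_step S T -> spur_step (iso_sub S) (iso_sub T).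
Proof.
case=> d [dS sp ->]; exists (fd d); split; first by rewrite /= mem_imset.
  move=> e'; have [e ->] := fd_surj e'; rewrite /= mem_imset // !srcE => eS /fvI.
  by move/(sp _ eS) => ->.
apply: iso_sub_eq => // x' /=.
  by have [v ->] := fv_surj x'; rewrite mem_imset // !inE srcE (inj_eq fvI) mem_imset.
by have [e ->] := fd_surj x'; rewrite mem_imset // !inE dinvE !(inj_eq fdI) mem_imset.
Qed.

Lemma iso_prune b (E : {set dart D}) : prune (fv b) (fd @: E) = fd @: prune b E.
Proof.
apply/setP => d'; have [d ->] := fd_surj d'.
rewrite mem_imset // !inE mem_imset //; congr (_ && ~~ (_ && _)); last first.
  by rewrite srcE tgtE !(inj_eq fvI).
apply/forallP/forallP => iso e.
  by have := iso (fd e); rewrite mem_imset // !inE dinvE tgtE !srcE !(inj_eq fdI) !(inj_eq fvI).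
have [e1 ->] := fd_surj e; have := iso e1.
by rewrite mem_imset // !inE dinvE tgtE !srcE !(inj_eq fdI) !(inj_eq fvI).
Qed.

Lemma iso_cell_step b S T :
  cell_step b S T -> cell_step (fv b) (iso_sub S) (iso_sub T).
Proof.
case=> c [d [k [/andP[cF k0] dc dA [dB vB] ->]]].
exists (fc c), (fd d), k; rewrite iso_orbit -map_take -map_drop /=.
set A := take k _ in dA *; set B := drop k _ in dB vB *.
have darts_eq : fd @: sE S :\: [set e | (e \in map fd A) || (dinv e \in map fd A)] =
    fd @: (sE S :\: [set e | (e \in A) || (dinv e \in A)]).
  apply/setP => d'; have [e ->] := fd_surj d'.
  by rewrite mem_imset // !inE mem_imset // dinvE !mem_map.
rewrite darts_eq iso_prune; split=> //.
- by rewrite mem_imset // cF.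
- by rewrite /fd iso_face dc.
- by move=> e' /mapP[e eA ->]; rewrite dinvE bd_dartsE dA.
- split=> e'; first by case/mapP=> e eB ->; rewrite dinvE bd_dartsE dB.
  by rewrite behead_map => /mapP[e eB ->]; rewrite srcE bd_verticesE vB.
apply: iso_sub_eq => // x' /=.
  have [v ->] := fv_surj x'.
  rewrite mem_imset // !inE mem_imset // (inj_eq fvI); congr (_ && (_ || _)).
  apply/esym/some_dart => e.
  by rewrite mem_imset // srcE (inj_eq fvI).
have [c1 ->] := fc_surj x'.
by rewrite mem_imset // !inE mem_imset // (inj_eq fcI).
Qed.

Lemma iso_shelling b N Sigma :
  based_shelling b N Sigma -> based_shelling (fv b) N (iso_sub \o Sigma).
Proof.
case=> S0 SN subS stepS; split=> /=.
- by rewrite S0; apply: iso_sub_eq => x' /=; rewrite inE; apply/imsetP;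
     [have [x ->] := fv_surj x' | have [x ->] := fd_surj x' | have [x ->] := fc_surj x'];
     exists x.
- by rewrite SN /iso_sub /= imset_set1 !imset0.
- move=> j /subS[? ? ? ?]; split; first exact: iso_subcomplex.
  + exact: iso_connected.
  + exact: iso_simply_connected.
  + by rewrite bd_verticesE.
- by move=> j /stepS[/iso_spur_step|/iso_cell_step]; [left | right].
Qed.

End Transport.

(** * Closed cochains on a disk diagram are coboundaries *)

Section Incidence.
Local Open Scope ring_scope.
Variables (T : finType) (n : nat) (s t : 'I_n -> T).

Definition incidence : 'M[rat]_(#|T|, n) :=
  \matrix_(i, j) ((t j == enum_val i)%:R - (s j == enum_val i)%:R).

Lemma mulmx_incidence (h : 'rV_#|T|) j :
  (h *m incidence) 0 j = h 0 (enum_rank (t j)) - h 0 (enum_rank (s j)).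
Proof.
have pickE x : \sum_i h 0 i * (x == enum_val i)%:R = h 0 (enum_rank x).
  rewrite (bigD1 (enum_rank x)) //= enum_rankK eqxx mulr1 big1 ?addr0 // => i ix.
  case: eqP => [xi|_]; last by rewrite mulr0.
  by rewrite xi enum_valK eqxx in ix.
rewrite mxE -!pickE -sumrB; apply: eq_bigr => i _.
by rewrite mxE mulrBr.
Qed.

(** The kernel consists of the functions that are constant along the edges, so
    connectedness leaves at most one dimension. *)
Lemma rank_incidence :
    (forall h : T -> rat, (forall j, h (t j) = h (s j)) -> forall x y, h x = h y) ->
  (#|T| <= (\rank incidence).+1)%N.
Proof.
move=> connT; have ker1 : (kermx incidence <= (const_mx 1 : 'rV_#|T|))%MS.
  apply/rV_subP => h /sub_kermxP h0.
  have hC x y : h 0 (enum_rank x) = h 0 (enum_rank y).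
    apply: (connT (fun x => h 0 (enum_rank x))) => j; apply/eqP.
    by rewrite -subr_eq0 -mulmx_incidence h0 mxE.
  apply/sub_rVP; case: (pickP T) => [x _|T0].
    exists (h 0 (enum_rank x)); apply/rowP => i.
    by rewrite !mxE mulr1 (hC x (enum_val i)) enum_valK.
  by exists 0; apply/rowP => i; have := T0 (enum_val i).
have := leq_trans (mxrankS ker1) (rank_leq_row _).
by rewrite mxrank_ker leq_subLR addn1.
Qed.

End Incidence.

Section Exactness.
Local Open Scope ring_scope.
Variable D : complex.
Hypothesis diskD : is_disk_diagram D.
Let dinvK := disk_dinvK diskD.
Let dinvI : injective (@dinv D) := inv_inj dinvK.
Let nxtI := disk_nxt_inj diskD.

(** One dart of each edge, chosen by comparing ranks in the enumeration. *)
Definition orientation : {set dart D} :=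
  [set d | (enum_rank d < enum_rank (dinv d))%N].

Lemma orientation_dinv d : (dinv d \in orientation) = (d \notin orientation).
Proof.
rewrite !inE dinvK -leqNgt ltn_neqAle; case: eqP => //= /val_inj/enum_rank_inj/eqP.
by rewrite (negPf (disk_dinv_neq diskD _)).
Qed.

Lemma dinv_orientation : (@dinv D) @: orientation = ~: orientation.
Proof.
apply/setP => d; rewrite -[d]dinvK mem_imset // in_setC orientation_dinv.
by rewrite dinvK.
Qed.

Lemma card_dart : #|dart D| = (#|orientation|).*2.
Proof.
rewrite -(cardsC orientation) -addnn -dinv_orientation.
by rewrite card_imset.
Qed.

Lemma sum_darts (V : zmodType) (F : dart D -> V) :
  \sum_d F d = \sum_(d in orientation) (F d + F (dinv d)).
Proof.
rewrite (bigID (mem orientation)) big_split /=; congr (_ + _).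
rewrite [RHS](reindex_inj dinvI); apply: eq_big => d; last by rewrite dinvK.
by rewrite orientation_dinv.
Qed.

Lemma vertices_constant (V : eqType) (h : vertex D -> V) :
  (forall d, h (tgt d) = h (src d)) -> forall u v, h u = h v.
Proof.
move=> hd u v; have /connectP[p up ->] := disk_connected diskD u v.
elim: p u up => [|w p IHp] u //= /andP[/existsP[d /andP[/eqP <- /eqP dw]] wp].
by rewrite -(IHp w) // -dw hd.
Qed.

(** The dual graph is connected: the rotation about a vertex passes from each
    region at this vertex to a neighbouring one, so [g] descends to a function
    on the vertices, constant along edges. *)
Lemma regions_constant (V : eqType) (g : option (cell D) -> V) :
  (forall d, g (face (dinv d)) = g (face d)) -> forall r s, g r = g s.
Proof.
move=> gd; suff faces d e : g (face d) = g (face e).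
  have outer_or_trivial (r : option (cell D)) :
      (exists d, face d = r) \/ r = None /\ #|dart D| = 0%N.
    case: r => [c|]; first by left; apply: (disk_cell diskD).
    by have [|/(disk_outer diskD)] := posnP #|dart D|; [right | left].
  move=> r s; case: (outer_or_trivial r) => [[d <-]|[-> D0]];
    case: (outer_or_trivial s) => [[e <-]|[-> D0']] //.
  - by have := max_card (pred1 d); rewrite card1 D0'.
  - by have := max_card (pred1 e); rewrite card1 D0.
have rot d' e' : src d' = src e' -> g (face d') = g (face e').
  move/(disk_rotation diskD)/iter_findex => <-.
  by elim: (findex _ _ _) => //= n ->; rewrite (face_nxt diskD) gd.
(* The value is optional only to cover a vertex without darts. *)
pose h u := if [pick d | src d == u] is Some d then Some (g (face d)) else None.
have hE d' : h (src d') = Some (g (face d')).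
  rewrite /h; case: pickP => [e' /eqP ed|/(_ d')]; first by rewrite (rot e' d').
  by rewrite eqxx.
have := @vertices_constant _ h _ (src d) (src e).
rewrite !hE => H; have [] // : Some (g (face d)) = Some (g (face e)).
by apply: H => d'; rewrite hE -src_dinv hE gd.
Qed.

Definition antisymmetric_on_darts (beta : dart D -> rat) :=
  forall d, beta (dinv d) = - beta d.

(** Along the cycle of [nxt] the end of a dart is the start of the following
    one. *)
Lemma sum_region_coboundary (h : vertex D -> rat) r :
  \sum_(d | face d == r) (h (tgt d) - h (src d)) = 0.
Proof.
rewrite sumrB [X in _ - X](reindex_inj nxtI) /=; apply/eqP; rewrite subr_eq0; apply/eqP.
by apply: eq_big => d; rewrite ?(face_nxt diskD) // (disk_src_nxt diskD).
Qed.

(** The vertex-edge and the region-edge incidence matrices both have corank at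
    most one, the complex and its dual being connected; by Euler's formula the
    coboundaries then fill the space of cochains that vanish on all regions. *)
Lemma exact_cochain (beta : dart D -> rat) :
    antisymmetric_on_darts beta ->
    (forall r, \sum_(d | face d == r) beta d = 0) ->
  exists h : vertex D -> rat, forall d, beta d = h (tgt d) - h (src d).
Proof.
move=> anti closed; pose e (o : 'I_#|orientation|) : dart D := enum_val o.
pose delta := incidence (fun o => src (e o)) (fun o => tgt (e o)).
pose dual := incidence (fun o => face (dinv (e o))) (fun o => face (e o)).
have sum_or (F : dart D -> rat) : \sum_(d in orientation) F d = \sum_o F (e o).
  exact: big_enum_val.
have e_surj d : d \in orientation -> exists o, e o = d.
  by move=> dO; exists (enum_rank_in dO d); rewrite /e enum_rankK_in.
have from_e (P : dart D -> Prop) :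
    (forall d, P d -> P (dinv d)) -> (forall o, P (e o)) -> forall d, P d.
  move=> Pinv Pe d; case: (boolP (d \in orientation)) => [/e_surj[o <-]//|].
  by rewrite -orientation_dinv => /e_surj[o dE]; rewrite -[d]dinvK -dE; apply: Pinv.
have dual_closed (b : dart D -> rat) : antisymmetric_on_darts b ->
    (forall r, \sum_(d | face d == r) b d = 0) ->
    (\row_o b (e o)) *m dual^T = 0.
  move=> antib closedb; apply/rowP => i; rewrite !mxE -[RHS](closedb (enum_val i)).
  rewrite [RHS]big_mkcond sum_darts sum_or; apply: eq_bigr => o _.
  rewrite !mxE antib /= mulrBr; congr (_ + _).
    by case: eqP => _; rewrite ?mulr1 ?mulr0.
  by case: eqP => _; rewrite ?mulr1 ?mulr0 ?oppr0.
(* Boundaries of boundaries vanish, hence coboundaries are closed. *)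
have delta_dual : (delta <= kermx dual^T)%MS.
  apply/row_subP => k; apply/sub_kermxP.
  pose h v : rat := (v == enum_val k)%:R.
  have -> : row k delta = \row_o (h (tgt (e o)) - h (src (e o))).
    by apply/rowP => o; rewrite !mxE.
  rewrite (dual_closed (fun d => h (tgt d) - h (src d))) //.
    by move=> d; rewrite tgt_dinv // src_dinv opprB.
  exact: sum_region_coboundary.
have rk_delta : (#|vertex D| <= (\rank delta).+1)%N.
  apply: rank_incidence => h hd; apply: vertices_constant; apply: from_e => // d.
  by rewrite tgt_dinv // src_dinv => ->.
have rk_dual : (#|{: option (cell D)}| <= (\rank dual).+1)%N.
  apply: rank_incidence => g gd; apply: regions_constant; apply: from_e => // d.
  by rewrite dinvK => ->.
(* Euler's formula: with [E] edges, [E - F = V - 1], so that the space of closed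
   cochains is no larger than the space of coboundaries. *)
have rk_eq : \rank (kermx dual^T) = \rank delta.
  apply/eqP; rewrite eqn_leq (mxrankS delta_dual) andbT mxrank_ker mxrank_tr.
  have := disk_euler diskD; rewrite card_dart doubleK addn1.
  move: (card_option (cell D)) rk_delta rk_dual; lia.
have /submxP[H betaH] : (\row_o beta (e o) <= delta)%MS.
  have beta_ker : (\row_o beta (e o) <= kermx dual^T)%MS.
    exact/sub_kermxP/dual_closed.
  apply: (submx_trans beta_ker).
  have [_ <-] := mxrank_leqif_sup delta_dual.
  by rewrite rk_eq.
exists (fun v => H 0 (enum_rank v)); apply: from_e => [d|o].
  by rewrite anti tgt_dinv // src_dinv => ->; rewrite opprB.
by have := congr1 (fun M : 'rV_ _ => M 0 o) betaH; rewrite mulmx_incidence mxE.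
Qed.

End Exactness.

(** * Signed area bounds the number of cells *)

Section BoundaryWords.
Variables (X : eqType) (D : diagram X).
Hypothesis diskD : is_disk_diagram D.

Lemma walk_word_rot (d e : dart D) : face d = face e ->
  walk_word e = rot (index e (orbit (@nxt D) d)) (walk_word d).
Proof.
move=> fde; have cyc := cycle_orbit (disk_nxt_inj diskD) d.
by rewrite /walk_word (orbitE cyc) ?orbit_uniq ?mem_orbit_nxt ?fde // map_rot.
Qed.

Lemma boundary_word_rot i w : is_boundary_word D w -> is_boundary_word D (rot i w).
Proof.
case=> [[d [fd ->]] | [D0 ->]]; last by right; case: i.
have [i_large|i_lt] := leqP (size (walk_word d)) i.
  by rewrite rot_oversize //; left; exists d.
rewrite /walk_word size_map in i_lt.
pose e := nth d (orbit (@nxt D) d) i.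
have fe : face e = face d by apply/eqP; rewrite -mem_orbit_nxt // mem_nth.
left; exists e; split; first by rewrite fe.
by rewrite (@walk_word_rot d e) ?fe // index_uniq // orbit_uniq.
Qed.

Lemma boundary_words_conjugate w w' : is_boundary_word D w ->
  is_boundary_word D w' -> exists i, w' = rot i w.
Proof.
case=> [[d [fd ->]] | [D0 ->]] [[e [fe ->]] | [D0' ->]].
- by rewrite (@walk_word_rot d e) ?fd ?fe //; eexists.
- by have := max_card (pred1 d); rewrite card1 D0'.
- by have := max_card (pred1 e); rewrite card1 D0.
- by exists 0.
Qed.

End BoundaryWords.

Lemma linvK (X : eqType) : involutive (@linv X).
Proof. by case=> x b; rewrite /linv /= negbK. Qed.

Lemma winvK (X : eqType) : involutive (@winv X).
Proof.
move=> w; rewrite /winv map_rev revK -map_comp map_id_in // => l _.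
exact: linvK.
Qed.

Section SignedArea.
Local Open Scope ring_scope.

Definition exponent (g : gen) (l : letter gen) : rat :=
  if l.1 == g then (if l.2 then 1 else -1) else 0.

Lemma exponent_linv g l : exponent g (linv l) = - exponent g l.
Proof.
by case: l => x b; rewrite /exponent /=; case: eqP; case: b; rewrite ?opprK ?oppr0.
Qed.

(** Twice the integral of y dx along the path in the plane spelled by a word,
    starting at height [h]. *)
Fixpoint moment (h : rat) (w : seq (letter gen)) : rat :=
  if w is l :: w' then
    (h + h + exponent gen_b l) * exponent gen_a l + moment (h + exponent gen_b l) w'
  else 0.

Lemma moment_nseq_a h n w :
  moment h (nseq n la ++ w) = 2 * h * n%:R + moment h w.
Proof.
elim: n => [|n IHn] /=; first by rewrite mulr0 add0r.
by rewrite /exponent /= !addr0 IHn -natr1; ring.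
Qed.

Lemma moment_nseq_A h n w :
  moment h (nseq n (linv la) ++ w) = - (2 * h * n%:R) + moment h w.
Proof.
elim: n => [|n IHn] /=; first by rewrite mulr0 oppr0 add0r.
by rewrite /exponent /= !addr0 IHn -natr1; ring.
Qed.

Lemma moment_nseq_b h n w : moment h (nseq n lb ++ w) = moment (h + n%:R) w.
Proof.
elim: n h => [|n IHn] h /=; first by rewrite addr0.
by rewrite /exponent /= mulr0 add0r IHn -addrA nat1r.
Qed.

Lemma moment_nseq_B h n w : moment h (nseq n (linv lb) ++ w) = moment (h - n%:R) w.
Proof.
elim: n h => [|n IHn] h /=; first by rewrite subr0.
by rewrite /exponent /= mulr0 add0r IHn -addrA -opprD nat1r.
Qed.

Lemma moment_commutator_word h p q : moment h (commutator_word p q) = - (2 * (p * q)%:R).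
Proof.
rewrite /commutator_word moment_nseq_a moment_nseq_b moment_nseq_A.
by rewrite -[nseq q _]cats0 moment_nseq_B /= natrM; ring.
Qed.

Section Diagram.
Variable D : diagram gen.
Hypothesis vkD : is_van_kampen commutator_relators D.
Let diskD := vk_disk vkD.

Definition expo g (d : dart D) := exponent g (label d).

Lemma expo_antisym g : antisymmetric_on_darts (expo g).
Proof. by move=> d; rewrite /expo (vk_label vkD) exponent_linv. Qed.

Lemma sum_region (F : dart D -> rat) d :
  \sum_(e | face e == face d) F e = \sum_(e <- orbit (@nxt D) d) F e.
Proof.
rewrite big_uniq ?orbit_uniq //; apply: eq_bigl => e.
by rewrite mem_orbit_nxt.
Qed.

(** The contributions of opposite darts cancel in the sum over all regions. *)
Lemma sum_outer_region (F : dart D -> rat) : antisymmetric_on_darts F ->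
  \sum_(d | face d == None) F d = - \sum_c \sum_(d | face d == Some c) F d.
Proof.
move=> anti; apply/eqP; rewrite -addr_eq0; apply/eqP.
rewrite -[LHS](_ : \sum_d F d = _).
  by rewrite sum_darts //; apply: big1 => d _; rewrite anti subrr.
rewrite (partition_big (@face D) predT) //= (bigD1 None) //=; congr (_ + _).
rewrite (reindex_omap Some id) /=; last by case.
by apply: eq_bigl => c; rewrite eqxx.
Qed.

Lemma cell_word c : exists2 d : dart D, face d = Some c &
  walk_word d = [:: la; lb; linv la; linv lb] \/
  walk_word d = [:: lb; la; linv lb; linv la].
Proof.
have [d [fd dR]] := vk_relator vkD c; exists d => //.
rewrite !inE in dR; case: dR => /eqP dR; [by left | right].
by rewrite -[walk_word d]winvK dR.
Qed.

(** The exponent of [b] sums to zero along the relator, hence around every cell,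
    hence also around the outer region. *)
Lemma exists_height : exists h : vertex D -> rat,
  forall d, expo gen_b d = h (tgt d) - h (src d).
Proof.
apply: exact_cochain => //; first exact: expo_antisym.
have cell0 c : \sum_(d | face d == Some c) expo gen_b d = 0.
  have [d <- dw] := cell_word c; rewrite sum_region -(big_map (@label _ D) predT).
  by rewrite -/(walk_word d); case: dw => ->; rewrite !big_cons big_nil /exponent /=; ring.
case=> [//|]; rewrite sum_outer_region; last exact: expo_antisym.
by rewrite big1 ?oppr0.
Qed.

Lemma sum_walk_moment (h : vertex D -> rat) d :
    (forall d, expo gen_b d = h (tgt d) - h (src d)) ->
  \sum_(e | face e == face d) (h (src e) + h (tgt e)) * expo gen_a e =
  moment (h (src d)) (walk_word d).
Proof.
move=> hE; rewrite sum_region /walk_word /orbit.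
move: (order _ d) => n; elim: n d => [|n IHn] e; first by rewrite big_nil.
rewrite /= big_cons IHn.
rewrite -/(expo gen_a e) -/(expo gen_b e) hE (disk_src_nxt diskD).
by congr (_ * _ + moment _ _); ring.
Qed.

(** The map to the plane given by the height and the exponent of [a] sends each
    cell to a unit square, of signed area one or minus one; the signed area
    enclosed by the boundary is therefore at most the number of cells. *)
Lemma area_ge_rectangle p q :
  is_boundary_word D (commutator_word p q) -> (p * q <= area D)%N.
Proof.
case=> [[d0 [fd0 w0]]|[_ w0]]; last by case: p q w0 => [|p] [|q].
have [h hE] := exists_height.
pose om e := (h (src e) + h (tgt e)) * expo gen_a e.
have om_anti : antisymmetric_on_darts om.
  by move=> d; rewrite /om expo_antisym tgt_dinv // src_dinv; ring.
have := sum_outer_region om_anti; rewrite -fd0 sum_walk_moment // -w0.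
rewrite moment_commutator_word => /oppr_inj sum_cells.
have le2 : 2 * (p * q)%:R <= \sum_(c : cell D) (2 : rat).
  rewrite sum_cells; apply: ler_sum => c _; have [d <- dw] := cell_word c.
  by rewrite sum_walk_moment //; case: dw => -> /=; rewrite /exponent /=; lra.
by move: le2; rewrite sumr_const -[X in _ <= X]mulr_natr ler_pM2l // ler_nat.
Qed.

End Diagram.
End SignedArea.

(** * Darts and regions of the grid *)

Section GridDarts.
Variables p q : nat.
Notation Q := (grid p.+1 q.+1).

(** Natural coordinates for points, edges and squares, so that the geometry
    reduces to arithmetic; they are meaningful inside the grid only. Darts
    named [hd] are horizontal and darts named [vd] vertical. *)
Definition pt x y : vertex Q := (inord x, inord y).
Definition hd x y o : dart Q := (inl (inord x, inord y), o).
Definition vd x y o : dart Q := (inr (inord x, inord y), o).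
Definition sq x y : cell Q := (inord x, inord y).

Lemma dartW (P : dart Q -> Prop) :
    (forall x y o, x <= p -> y <= q.+1 -> P (hd x y o)) ->
    (forall x y o, x <= p.+1 -> y <= q -> P (vd x y o)) -> forall d, P d.
Proof.
move=> Ph Pv [[[x y]|[x y]] o].
  rewrite (_ : (_, o) = hd x y o); first by apply: Ph; rewrite -ltnS.
  by rewrite /hd !inord_val.
rewrite (_ : (_, o) = vd x y o); first by apply: Pv; rewrite -ltnS.
by rewrite /vd !inord_val.
Qed.

Lemma ptW (P : vertex Q -> Prop) :
  (forall x y, x <= p.+1 -> y <= q.+1 -> P (pt x y)) -> forall u, P u.
Proof.
move=> Pp [x y]; rewrite (_ : (_, _) = pt x y); first by apply: Pp; rewrite -ltnS.
by rewrite /pt !inord_val.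
Qed.

Lemma sqW (P : cell Q -> Prop) :
  (forall x y, x <= p -> y <= q -> P (sq x y)) -> forall c, P c.
Proof.
move=> Pp [x y]; rewrite (_ : (_, _) = sq x y); first by apply: Pp; rewrite -ltnS.
by rewrite /sq !inord_val.
Qed.

Lemma inord_eq n i j : i <= n -> j <= n -> (inord i == inord j :> 'I_n.+1) = (i == j).
Proof. by move=> i_n j_n; rewrite -val_eqE /= !inordK. Qed.

Lemma pt_eq x y x' y' : x <= p.+1 -> y <= q.+1 -> x' <= p.+1 -> y' <= q.+1 ->
  (pt x y == pt x' y') = (x == x') && (y == y').
Proof. by move=> *; rewrite /pt xpair_eqE !inord_eq. Qed.

Lemma sq_eq x y x' y' : x <= p -> y <= q -> x' <= p -> y' <= q ->
  (sq x y == sq x' y') = (x == x') && (y == y').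
Proof. by move=> *; rewrite /sq xpair_eqE !inord_eq. Qed.

Lemma hd_eq x y o x' y' o' : x <= p -> y <= q.+1 -> x' <= p -> y' <= q.+1 ->
  (hd x y o == hd x' y' o') = [&& x == x', y == y' & o == o'].
Proof.
move=> *; rewrite /hd xpair_eqE -[inl _ == _]/((_, _) == (_, _)) xpair_eqE.
by rewrite !inord_eq // andbA.
Qed.

Lemma vd_eq x y o x' y' o' : x <= p.+1 -> y <= q -> x' <= p.+1 -> y' <= q ->
  (vd x y o == vd x' y' o') = [&& x == x', y == y' & o == o'].
Proof.
move=> *; rewrite /vd xpair_eqE -[inr _ == _]/((_, _) == (_, _)) xpair_eqE.
by rewrite !inord_eq // andbA.
Qed.

Lemma hd_vd x y o x' y' o' : (hd x y o == vd x' y' o') = false.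
Proof. by []. Qed.

Lemma vd_hd x y o x' y' o' : (vd x y o == hd x' y' o') = false.
Proof. by []. Qed.

Lemma dinv_hd x y o : dinv (hd x y o) = hd x y (~~ o). Proof. by []. Qed.
Lemma dinv_vd x y o : dinv (vd x y o) = vd x y (~~ o). Proof. by []. Qed.

Lemma src_hd x y o : x <= p -> y <= q.+1 -> src (hd x y o) = pt (x + ~~ o) y.
Proof.
move=> xp yq; congr pair; apply/val_inj; case: o => /=.
  by rewrite !inordK ?addn0 // !ltnS; lia.
by rewrite /= /bump /= !inordK ?ltnS //; lia.
Qed.

Lemma src_vd x y o : x <= p.+1 -> y <= q -> src (vd x y o) = pt x (y + ~~ o).
Proof.
move=> xp yq; congr pair; apply/val_inj; case: o => /=.
  by rewrite !inordK ?addn0 // !ltnS; lia.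
by rewrite /= /bump /= !inordK ?ltnS //; lia.
Qed.

Lemma tgt_hd x y o : x <= p -> y <= q.+1 -> tgt (hd x y o) = pt (x + o) y.
Proof. by move=> xp yq; rewrite /tgt dinv_hd src_hd // negbK. Qed.

Lemma tgt_vd x y o : x <= p.+1 -> y <= q -> tgt (vd x y o) = pt x (y + o).
Proof. by move=> xp yq; rewrite /tgt dinv_vd src_vd // negbK. Qed.

Lemma gpairE m n x y : gpair m.+1 n.+1 x y =
  if (x <= m) && (y <= n) then Some (inord x, inord y) else None.
Proof.
rewrite /gpair; case: insubP => [i|]; rewrite ltnS; last by move/negPf->.
move=> -> ix; case: insubP => [j|]; rewrite ltnS; last by move/negPf->.
by move=> -> jy; rewrite -ix -jy !inord_val.
Qed.

Lemma face_hd x y o : x <= p -> y <= q.+1 -> face (hd x y o) =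
  if o then (if 0 < y then Some (sq x y.-1) else None)
  else (if y <= q then Some (sq x y) else None).
Proof.
move=> xp yq; rewrite /face /=; case: o; rewrite !inordK ?ltnS //; last by rewrite gpairE xp.
by case: y yq => [|y] //= yq; rewrite gpairE xp -ltnS yq.
Qed.

Lemma face_vd x y o : x <= p.+1 -> y <= q -> face (vd x y o) =
  if o then (if x <= p then Some (sq x y) else None)
  else (if 0 < x then Some (sq x.-1 y) else None).
Proof.
move=> xp yq; rewrite /face /=; case: o; rewrite !inordK ?ltnS //; first by rewrite gpairE yq andbT.
by case: x xp => [|x] //= xp; rewrite gpairE yq -ltnS xp.
Qed.

Lemma gout_pt x y t : x <= p.+1 -> y <= q.+1 -> gout (pt x y : gvertex _ _) t =
  match t %% 4 with
  | 0 => if x <= p then Some (hd x y true) else None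
  | 1 => if y <= q then Some (vd x y true) else None
  | 2 => if 0 < x then Some (hd x.-1 y false) else None
  | _ => if 0 < y then Some (vd x y.-1 false) else None
  end.
Proof.
move=> xp yq; rewrite /gout /= !inordK ?ltnS // /hdart /vdart.
case: (t %% 4) => [|[|[|_]]].
- by rewrite gpairE yq andbT; case: ifP.
- by rewrite gpairE xp /=; case: ifP.
- by case: x xp => [|x] //= xp; rewrite gpairE -ltnS xp yq.
- by case: y yq => [|y] //= yq; rewrite gpairE xp -ltnS yq.
Qed.

Lemma nxt_east x y : x <= p -> y <= q.+1 -> nxt (hd x y true) =
  if 0 < y then vd x.+1 y.-1 false
  else if x < p then hd x.+1 y true else vd x.+1 y true.
Proof.
move=> xp yq; have tE : tgt (hd x y true) = pt x.+1 y by rewrite tgt_hd // addn1.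
rewrite /= /gnxt -[gsrc _]/(tgt (hd x y true)) {}tE !gout_pt //=; case: y yq => [|y] yq //=.
by case: (x < p).
Qed.

Lemma nxt_north x y : x <= p.+1 -> y <= q -> nxt (vd x y true) =
  if x <= p then hd x y.+1 true
  else if y < q then vd x y.+1 true else hd x.-1 y.+1 false.
Proof.
move=> xp yq; have tE : tgt (vd x y true) = pt x y.+1 by rewrite tgt_vd // addn1.
rewrite /= /gnxt -[gsrc _]/(tgt (vd x y true)) {}tE !gout_pt //=; case: (leqP x p) => //= px.
by case: (y < q); rewrite //= (leq_ltn_trans _ px).
Qed.

Lemma nxt_west x y : x <= p -> y <= q.+1 -> nxt (hd x y false) =
  if y <= q then vd x y true
  else if 0 < x then hd x.-1 y false else vd x y.-1 false.
Proof.
move=> xp yq; have tE : tgt (hd x y false) = pt x y by rewrite tgt_hd // addn0.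
rewrite /= /gnxt -[gsrc _]/(tgt (hd x y false)) {}tE.
rewrite !gout_pt //= ?(leq_trans xp) //; case: (leqP y q) => //= qy.
by case: (0 < x); rewrite //= (leq_ltn_trans _ qy).
Qed.

Lemma nxt_south x y : x <= p.+1 -> y <= q -> nxt (vd x y false) =
  if 0 < x then hd x.-1 y false
  else if 0 < y then vd x y.-1 false else hd x y true.
Proof.
move=> xp yq; have tE : tgt (vd x y false) = pt x y by rewrite tgt_vd // addn0.
rewrite /= /gnxt -[gsrc _]/(tgt (vd x y false)) {}tE.
rewrite !gout_pt //= ?(leq_trans yq) //; case: x xp => //= xp.
by case: (0 < y).
Qed.

(** In clockwise order, as [nxt] runs through them. *)
Definition sides x y : seq (dart Q) :=
  [:: vd x y true; hd x y.+1 true; vd x.+1 y false; hd x y false].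

(** In counterclockwise order from the lower left corner, as [nxt] runs through
    them. *)
Definition outer_sides : seq (dart Q) :=
  mkseq (fun i => hd i 0 true) p.+1 ++ mkseq (fun j => vd p.+1 j true) q.+1 ++
  mkseq (fun i => hd (p - i) q.+1 false) p.+1 ++
  mkseq (fun j => vd 0 (q - j) false) q.+1.

Definition region_sides (r : option (cell Q)) :=
  if r is Some c then sides c.1 c.2 else outer_sides.

Lemma sides_uniq x y : uniq (sides x y).
Proof. by rewrite /= !inE !xpair_eqE !andbF. Qed.

Lemma sides_cycle x y : x <= p -> y <= q -> fcycle (@nxt Q) (sides x y).
Proof.
move=> xp yq; apply/and5P; split=> //; apply/eqP.
- by rewrite nxt_north ?xp // leqW.
- by rewrite nxt_east ?ltnS.
- by rewrite nxt_south.
- by rewrite nxt_west ?yq // leqW.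
Qed.

Lemma mem_sides x y d : x <= p -> y <= q ->
  (d \in sides x y) = (face d == Some (sq x y)).
Proof.
move=> xp yq; have none_eq (c : cell Q) : (None == Some c) = false by [].
move: d; apply: dartW => x' y' o xp' yq'.
  rewrite !inE !hd_vd !hd_eq ?(leqW yq) // face_hd //; case: o.
    by case: ifP => y0; rewrite ?none_eq ?(inj_eq Some_inj) ?sq_eq; lia.
  by case: ifP => y0; rewrite ?none_eq ?(inj_eq Some_inj) ?sq_eq; lia.
rewrite !inE !vd_hd !vd_eq ?(leqW xp) // face_vd //; case: o.
  by case: ifP => y0; rewrite ?none_eq ?(inj_eq Some_inj) ?sq_eq; lia.
by case: ifP => y0; rewrite ?none_eq ?(inj_eq Some_inj) ?sq_eq; lia.
Qed.

Lemma fpath_mkseq (T : eqType) (f : T -> T) (x : T) (g : nat -> T) n :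
  f x = g 0 -> (forall i, i < n -> f (g i) = g i.+1) -> fpath f x (mkseq g n.+1).
Proof.
elim: n x g => [|n IHn] x g fx fg; first by rewrite /= fx eqxx.
rewrite /mkseq /= fx eqxx /= -[2]addn1 iotaDl -map_comp.
apply: (IHn _ (fun i => g i.+1)); first exact: fg.
by move=> i i_n; apply: fg.
Qed.

Lemma last_mkseq (T : Type) (x : T) (g : nat -> T) n : last x (mkseq g n.+1) = g n.
Proof. by rewrite /mkseq -addn1 iotaD map_cat last_cat. Qed.

Lemma outer_sides_cycle : fcycle (@nxt Q) outer_sides.
Proof.
rewrite (cycle_path (hd 0 0 true)) !cat_path !last_cat !last_mkseq.
rewrite !subnn; apply/and4P; split; apply: fpath_mkseq => [|i i_lt].
- by rewrite nxt_south.
- by rewrite nxt_east ?i_lt // ltnW.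
- by rewrite nxt_east // !ltnn.
- by rewrite nxt_north ?ltnn ?i_lt // ltnW.
- by rewrite nxt_north ?ltnn // subn0.
- rewrite nxt_west ?leq_subr // ltnn subn_gt0 i_lt; congr hd; lia.
- by rewrite nxt_west // !ltnn subn0.
- rewrite nxt_south ?leq_subr //= subn_gt0 i_lt; congr vd; lia.
Qed.

Lemma mem_mkseq (T : eqType) (g : nat -> T) n z :
  reflect (exists2 i, i < n & z = g i) (z \in mkseq g n).
Proof.
by apply: (iffP mapP) => -[i]; rewrite ?mem_iota => ? ->; exists i; rewrite ?mem_iota.
Qed.

Lemma mem_outer_sides d : (d \in outer_sides) = (face d == None).
Proof.
apply/idP/eqP.
  rewrite !mem_cat => /or4P[] /mem_mkseq[i i_lt ->].
  - by rewrite face_hd.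
  - by rewrite face_vd ?ltnn.
  - by rewrite face_hd ?ltnn ?leq_subr.
  - by rewrite face_vd ?leq_subr.
move: d; apply: dartW => x y o xp yq; rewrite ?face_hd ?face_vd // !mem_cat.
  case: o; case: ifP => // cond _; apply/or4P.
    by constructor 1; apply/mem_mkseq; exists x; rewrite ?ltnS //; congr hd; lia.
  constructor 3; apply/mem_mkseq; exists (p - x); first by lia.
  by congr hd; lia.
case: o; case: ifP => // cond _; apply/or4P.
  by constructor 2; apply/mem_mkseq; exists y; rewrite ?ltnS //; congr vd; lia.
constructor 4; apply/mem_mkseq; exists (q - y); first by lia.
by congr vd; lia.
Qed.

Lemma outer_sides_uniq : uniq outer_sides.
Proof.
have mkU (g : nat -> dart Q) n : (forall i j, i < n -> j < n -> g i = g j -> i = j) ->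
    uniq (mkseq g n).
  move=> gI; rewrite map_inj_in_uniq ?iota_uniq // => i j.
  by rewrite !mem_iota; apply: gI.
rewrite !cat_uniq; apply/and5P; split.
- by apply: mkU => i j ? ? /eqP; rewrite hd_eq //; lia.
- by apply/hasPn => d; rewrite !mem_cat => /or3P[] /mem_mkseq[i _ ->];
    apply/mem_mkseq => -[j _].
- by apply: mkU => i j ? ? /eqP; rewrite vd_eq //; lia.
- by apply/hasPn => d; rewrite !mem_cat => /orP[] /mem_mkseq[i _ ->];
    apply/mem_mkseq => -[j _].
rewrite mkU ?andTb; last by move=> i j ? ? /eqP; rewrite hd_eq; lia.
apply/andP; split; last by apply: mkU => i j ? ? /eqP; rewrite vd_eq; lia.
by apply/hasPn => d /mem_mkseq[i _ ->]; apply/mem_mkseq => -[j _].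
Qed.

Lemma regions_fibres : injective (@nxt Q) /\
  forall d e : dart Q, face d = face e <-> fconnect (@nxt Q) d e.
Proof.
apply: (@fconnect_fibres _ _ _ _ region_sides).
- case=> [c|]; last exact: outer_sides_uniq.
  exact: sides_uniq.
- case=> [c|]; last exact: outer_sides_cycle.
  by apply: sides_cycle; rewrite -ltnS.
- case=> [|d]; last exact: mem_outer_sides.
  apply: sqW => x y xp yq d; rewrite /= !inordK ?ltnS //.
  exact: mem_sides.
Qed.

End GridDarts.

(** * The grid is a pure area-minimising disk diagram *)

Section GridDisk.
Variables p q : nat.
Notation Q := (grid p.+1 q.+1).

Lemma gout_src (u : gvertex p.+1 q.+1) t d : gout u t = Some d ->
  src (d : dart Q) = u /\ gdir d = t %% 4.
Proof.
elim/(@ptW p q): u => x y xp yq; rewrite gout_pt //.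
have : t %% 4 < 4 by rewrite ltn_mod.
case: (t %% 4) => [|[|[|[|//]]]] _.
- by case: ifP => // xp' [<-]; rewrite src_hd // addn0.
- by case: ifP => // yq' [<-]; rewrite src_vd // addn0.
- by case: ifP => // xp' [<-]; rewrite src_hd //; [rewrite addn1 prednK | lia].
- by case: ifP => // xp' [<-]; rewrite src_vd //; [rewrite addn1 prednK | lia].
Qed.

Lemma gout_gdir (d : dart Q) : gout (src d : gvertex p.+1 q.+1) (gdir d) = Some d.
Proof.
move: d; apply: dartW => x y o xp yq.
  rewrite src_hd // gout_pt //; last by case: o; lia.
  by case: o; rewrite /= ?addn0 ?addn1 ?xp.
rewrite src_vd // gout_pt //; last by case: o; lia.
by case: o; rewrite /= ?addn0 ?addn1 ?yq.
Qed.

(** The directions are listed counterclockwise, the sense in which [nxt \o dinv]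
    turns. *)
Definition star (u : vertex Q) : seq (dart Q) :=
  pmap (gout (u : gvertex p.+1 q.+1)) [:: 0; 1; 2; 3].

Lemma mem_star u d : (d \in star u) = (src d == u).
Proof.
apply/idP/eqP => [|<-].
  rewrite mem_pmap => /mapP[t _ /esym /gout_src[]] //.
by rewrite mem_pmap; apply/mapP; exists (gdir d); rewrite ?gout_gdir //; case: d => [[?|?] []].
Qed.

(** Reversing a dart and then turning right if possible amounts to looking for
    the next dart counterclockwise about its origin. *)
Lemma gnxt_dinv (u : gvertex p.+1 q.+1) t d : gout u t = Some d ->
  nxt (dinv (d : dart Q)) =
    if gout u (t + 1) is Some e then e else
    if gout u (t + 2) is Some e then e else
    if gout u (t + 3) is Some e then e else d.
Proof.
move=> /gout_src[du dt].
have dK : gdinv (gdinv d) = d by rewrite /gdinv /= negbK; case: (d).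
have dirE : gdir (gdinv d) = gdir d + 2 %[mod 4] by move: (d) => [[[? ?]|[? ?]] []].
have goutE n k : gdir (gdinv d) + n = t + k %[mod 4] ->
    gout u (gdir (gdinv d) + n) = gout u (t + k) by rewrite /gout => ->.
rewrite /= /gnxt dK (_ : gsrc d = u) //.
have dirt : gdir (gdinv d) = t + 2 %[mod 4] by rewrite dirE dt modnDml.
have shift n k : 2 + n = k %[mod 4] -> gdir (gdinv d) + n = t + k %[mod 4].
  by move=> nk; rewrite -modnDml dirt modnDml -addnA -modnDmr nk modnDmr.
have e2 : gout u (gdir (gdinv d)) = gout u (t + 2) by rewrite /gout dirt.
rewrite (goutE 3 1) ?(goutE 1 3) ?e2 //; exact: shift.
Qed.

Lemma star_cycle u : fcycle (fun d : dart Q => nxt (dinv d)) (star u).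
Proof.
have period t : gout (u : gvertex p.+1 q.+1) (t + 4) = gout u t by rewrite /gout modnDr.
have n0 d := @gnxt_dinv u 0 d; have n1 d := @gnxt_dinv u 1 d.
have n2 d := @gnxt_dinv u 2 d; have n3 d := @gnxt_dinv u 3 d; move: n0 n1 n2 n3 => /=.
rewrite -[gout u 4]/(gout u (0 + 4)) -[gout u 5]/(gout u (1 + 4)).
rewrite -[gout u 6]/(gout u (2 + 4)) !period /star /=.
case: (gout u 0) => [d0|]; case: (gout u 1) => [d1|]; case: (gout u 2) => [d2|];
  case: (gout u 3) => [d3|] n0 n1 n2 n3 //=;
  rewrite ?(n0 _ (erefl _)) ?(n1 _ (erefl _)) ?(n2 _ (erefl _)) ?(n3 _ (erefl _)) ?eqxx //.
Qed.

Lemma star_uniq u : uniq (star u).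
Proof.
apply: (@map_uniq _ _ (@gdir p.+1 q.+1)); rewrite /star /=.
have dirE t d : t < 4 -> gout (u : gvertex p.+1 q.+1) t = Some d -> gdir d = t.
  by move=> t4 /gout_src[_ ->]; rewrite modn_small.
case e0: (gout u 0) => [d0|]; case e1: (gout u 1) => [d1|];
case e2: (gout u 2) => [d2|]; case e3: (gout u 3) => [d3|] //=;
by rewrite ?(dirE _ _ _ e0) ?(dirE _ _ _ e1) ?(dirE _ _ _ e2) ?(dirE _ _ _ e3).
Qed.

Lemma grid_connected (u v : vertex Q) : connect (@adjacent Q) u v.
Proof.
have adj_sym : symmetric (@adjacent Q).
  suff half (u1 u2 : vertex Q) : adjacent u1 u2 -> adjacent u2 u1.
    by move=> u1 u2; apply/idP/idP => /half.
  case/existsP => d /andP[/eqP <- /eqP <-]; apply/existsP; exists (dinv d).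
  rewrite eqxx /tgt; apply/eqP; congr src.
  by rewrite /dinv /= /gdinv negbK; case: (d).
suff toO w : connect (@adjacent Q) w (pt p q 0 0).
  apply: connect_trans (toO u) _; rewrite (same_connect_r _ (toO v)) //.
  exact: sym_connect_sym.
move: w; apply: ptW => x y; elim: x => [|x IHx] xp; last first.
  move=> yq; apply: connect_trans (IHx (ltnW xp) yq).
  apply: connect1; apply/existsP; exists (hd p q x y false).
  by rewrite src_hd ?tgt_hd // addn0 addn1 !eqxx.
elim: y => [|y IHy] yq //; apply: connect_trans (IHy (ltnW yq)).
apply: connect1; apply/existsP; exists (vd p q 0 y false).
by rewrite src_vd ?tgt_vd // addn0 addn1 !eqxx.
Qed.

Lemma grid_disk : is_disk_diagram Q.
Proof.
have [nI regE] := regions_fibres p q.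
have [_ rotE] := fconnect_fibres star_uniq star_cycle mem_star.
split=> //.
- by case=> e o; rewrite /= /gdinv /= negbK.
- by case=> e o; rewrite xpair_eqE /= andbC; case: o.
- apply: dartW => x y [] xp yq.
  + rewrite nxt_east // tgt_hd // addn1.
    case: ifP => y0; first by rewrite src_vd ?addn1 ?prednK //; lia.
    case: ifP => x_lt; first by rewrite src_hd // addn0.
    by rewrite src_vd ?addn0 //; lia.
  + rewrite nxt_west // tgt_hd // addn0.
    case: ifP => y0; first by rewrite src_vd ?addn0 // ltnW.
    case: ifP => x_gt; first by rewrite src_hd ?addn1 ?prednK //; lia.
    by rewrite src_vd ?addn1 ?prednK //; lia.
  + rewrite nxt_north // tgt_vd // addn1.
    case: ifP => x0; first by rewrite src_hd ?addn0.
    case: ifP => y_lt; first by rewrite src_vd ?addn0.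
    by rewrite src_hd ?addn1 ?prednK //; lia.
  + rewrite nxt_south // tgt_vd // addn0.
    case: ifP => x0; first by rewrite src_hd ?addn1 ?prednK ?leqW //; lia.
    case: ifP => y_gt; first by rewrite src_vd ?addn1 ?prednK //; lia.
    by rewrite src_hd ?addn0 //; lia.
- apply: sqW => x y xp yq; exists (vd p q x y true).
  by rewrite face_vd ?xp // leqW.
- by exists (hd p q 0 0 true); rewrite face_hd.
- exact: grid_connected.
rewrite /= !card_prod card_sum !card_prod !card_ord card_bool muln2 doubleK; lia.
Qed.

Lemma grid_pure : is_pure Q.
Proof.
apply: dartW => x y o xp yq; rewrite ?dinv_hd ?dinv_vd ?face_hd ?face_vd //.
  by case: o => /=; case: y yq => [|y] //= yq; try (by left); try (by right);
    rewrite -ltnS yq; (left + right).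
by case: o => /=; case: x xp => [|x] //= xp; try (by left); try (by right);
    rewrite -ltnS xp; (left + right).
Qed.

End GridDisk.

Section GridWords.
Variables p q : nat.
Notation Q := (grid p.+1 q.+1).
Let diskQ := grid_disk p q.

Lemma grid_van_kampen : is_van_kampen commutator_relators Q.
Proof.
split=> //.
apply: sqW => x y xp yq; exists (vd p q x y true); split.
  by rewrite face_vd ?xp // leqW.
right; rewrite /walk_word (orbitE (sides_cycle xp yq)) ?sides_uniq ?mem_head //.
by rewrite /= eqxx rot0.
Qed.

Lemma grid_boundary_word : is_boundary_word Q (commutator_word p.+1 q.+1).
Proof.
left; exists (hd p q 0 0 true); split; first by rewrite face_hd.
rewrite /walk_word (orbitE (outer_sides_cycle p q)) ?outer_sides_uniq //; last first.
  by rewrite mem_outer_sides face_hd.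
rewrite [index _ _](_ : _ = 0); last by rewrite /= eqxx.
rewrite rot0 !map_cat /mkseq -!map_comp.
have mapC (c : letter gen) m n : [seq c | _ <- iota m n] = nseq n c.
  by elim: n m => //= n IHn m; rewrite IHn.
by rewrite /commutator_word -(mapC la 0) -(mapC lb 0) -(mapC (linv la) 0) -(mapC (linv lb) 0).
Qed.

Lemma commutator_word_reduced : cyclically_reduced (commutator_word p.+1 q.+1).
Proof.
pose e (l m : letter gen) := m != linv l.
have run l m n : e l m -> e m m -> path e l (nseq n.+1 m).
  by move=> lm mm; rewrite /= lm /=; elim: n => //= n ->; rewrite mm.
have last_run (l m : letter gen) n : last l (nseq n.+1 m) = m.
  by rewrite /=; elim: n => //=.
rewrite /cyclically_reduced (cycle_path la) !cat_path !last_cat !last_run.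
by rewrite !run.
Qed.

Lemma grid_boundary_reduced w : is_boundary_word Q w -> cyclically_reduced w.
Proof.
move=> Qw; have [i ->] := boundary_words_conjugate diskQ grid_boundary_word Qw.
by rewrite /cyclically_reduced rot_cycle; exact: commutator_word_reduced.
Qed.

Lemma grid_area_minimising : area_minimising commutator_relators Q.
Proof.
split=> [|D' w vkD' Qw D'w]; first exact: grid_van_kampen.
have [i wE] := boundary_words_conjugate diskQ Qw grid_boundary_word.
have := boundary_word_rot (vk_disk vkD') i D'w; rewrite -wE.
move/(area_ge_rectangle vkD'); apply: leq_trans.
by rewrite /area /= card_prod !card_ord.
Qed.

End GridWords.

(** * Shelling the grid from its lower left corner *)

Section Staircase.
Variables p q : nat.
Notation Q := (grid p.+1 q.+1).
Notation pt := (pt p q).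
Notation hd := (hd p q).
Notation vd := (vd p q).
Notation sq := (sq p q).
Let diskQ := grid_disk p q.

Definition first_cells n : {set cell Q} := [set c : cell Q | c.2 * p.+1 + c.1 < n].

(** Stages of the shelling in reverse order: rows below the current one are
    complete, and the current one is filled from the left. *)
Definition staircase n : subcomplex Q := hull (pt 0 0 : vertex Q) (first_cells n).

Lemma mem_first_cells n x y : x <= p -> y <= q ->
  (sq x y \in first_cells n) = (y * p.+1 + x < n).
Proof. by move=> xp yq; rewrite inE /= !inordK. Qed.

Lemma hd_in_staircase n x y o : x <= p -> y <= q.+1 ->
  (hd x y o \in sE (staircase n)) = (y.-1 * p.+1 + x < n).
Proof.
move=> xp yq; rewrite inE dinv_hd !face_hd //.
transitivity (((y <= q) && (y * p.+1 + x < n)) || ((0 < y) && (y.-1 * p.+1 + x < n))).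
  case: o; [rewrite orbC|]; congr (_ || _); case: ifP => // y0;
  by rewrite /= mem_first_cells //; lia.
by case: y yq => [|y] yq /=; lia.
Qed.

Lemma vd_in_staircase n x y o : x <= p.+1 -> y <= q ->
  (vd x y o \in sE (staircase n)) = (y * p.+1 + x.-1 < n).
Proof.
move=> xp yq; rewrite inE dinv_vd !face_vd //.
transitivity (((x <= p) && (y * p.+1 + x < n)) || ((0 < x) && (y * p.+1 + x.-1 < n))).
  case: o; [|rewrite orbC]; congr (_ || _); case: ifP => // y0;
  by rewrite /= mem_first_cells //; lia.
by case: x xp => [|x] xp /=; lia.
Qed.

Lemma pt_in_staircase n x y : x <= p.+1 -> y <= q.+1 ->
  (pt x y \in sV (staircase n)) = (x == 0) && (y == 0) || (y.-1 * p.+1 + x.-1 < n).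
Proof.
move=> xp yq; rewrite inE pt_eq //; case: (boolP (_ && _)) => [//|not0]; rewrite !orFb.
apply/existsP/idP => [[d /andP[]]|xy_n].
  move: d; apply: dartW => x' y' o xp' yq'.
    rewrite hd_in_staircase // src_hd // => lt_n; rewrite pt_eq //; last by case: (o); lia.
    by case: o => /andP[/eqP <- /eqP <-]; rewrite ?addn0 ?addn1 /=; lia.
  rewrite vd_in_staircase // src_vd // => lt_n; rewrite pt_eq //; last by case: (o); lia.
  case: o => /andP[/eqP <- /eqP <-]; rewrite ?addn0 ?addn1 /=; last by lia.
  by case: (y') lt_n => [|y''] /=; lia.
case: x xp xy_n not0 => [|x] xp xy_n not0.
  case: y yq xy_n not0 => [|y] // yq xy_n _.
  by exists (vd 0 y false); rewrite vd_in_staircase // src_vd // addn1 eqxx andbT.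
by exists (hd x y false); rewrite hd_in_staircase // src_hd // addn1 eqxx andbT.
Qed.

Lemma staircase_subcomplex n : is_subcomplex (staircase n).
Proof. exact: hull_subcomplex. Qed.

Fixpoint west x y : seq (dart Q) :=
  if x is x'.+1 then hd x' y false :: west x' y else [::].
Fixpoint south y : seq (dart Q) :=
  if y is y'.+1 then vd 0 y' false :: south y' else [::].

Definition home (u : vertex Q) := west u.1 u.2 ++ south u.2.

Lemma homeE x y : x <= p.+1 -> y <= q.+1 -> home (pt x y) = west x y ++ south y.
Proof. by move=> xp yq; rewrite /home /= !inordK. Qed.

Lemma home_walk n u : u \in sV (staircase n) -> walk (staircase n) u (home u) (pt 0 0).
Proof.
move: u; apply: ptW => x y xp yq; rewrite homeE //.
elim: x xp => [|x IHx] xp.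
  elim: y yq => [|y IHy] yq xyS; first by rewrite /= eqxx.
  have xy_n : y * p.+1 + 0 < n by move: xyS; rewrite pt_in_staircase.
  rewrite (_ : pt 0 y.+1 = src (vd 0 y false)).
    apply: walk_cons; first by rewrite vd_in_staircase.
    rewrite tgt_vd // addn0; apply: IHy; first exact: ltnW.
    by rewrite pt_in_staircase ?(ltnW yq) //; case: (y) xy_n => //= y'; lia.
  by rewrite src_vd // addn1.
move=> xyS; have xy_n : y.-1 * p.+1 + x < n by move: xyS; rewrite pt_in_staircase.
rewrite (_ : pt x.+1 y = src (hd x y false)); last by rewrite src_hd // addn1.
apply: walk_cons; first by rewrite hd_in_staircase.
rewrite tgt_hd // addn0; apply: IHx; first exact: ltnW.
by rewrite pt_in_staircase ?(ltnW xp) //; lia.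
Qed.

Lemma orbit_right x y : x <= p -> y <= q -> orbit (@nxt Q) (vd x.+1 y false) =
  [:: vd x.+1 y false; hd x y false; vd x y true; hd x y.+1 true].
Proof.
move=> xp yq; rewrite (orbitE (sides_cycle xp yq)) ?sides_uniq //.
  rewrite (_ : index _ _ = 2) //= !vd_eq ?hd_vd ?eqxx ?andbF //; exact: leqW.
by rewrite !inE eqxx !orbT.
Qed.

Lemma orbit_top x y : x <= p -> y <= q -> orbit (@nxt Q) (hd x y.+1 true) =
  [:: hd x y.+1 true; vd x.+1 y false; hd x y false; vd x y true].
Proof.
move=> xp yq; rewrite (orbitE (sides_cycle xp yq)) ?sides_uniq //.
  by rewrite (_ : index _ _ = 1) //= ?vd_hd eqxx.
by rewrite !inE eqxx !orbT.
Qed.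

Lemma orbit_left x y : x <= p -> y <= q -> orbit (@nxt Q) (vd x y true) =
  [:: vd x y true; hd x y.+1 true; vd x.+1 y false; hd x y false].
Proof.
move=> xp yq; rewrite (orbitE (sides_cycle xp yq)) ?sides_uniq //.
  by rewrite (_ : index _ _ = 0) //= eqxx.
by rewrite !inE eqxx.
Qed.

(** A horizontal edge lies on the path of its eastern end. The paths from the two
    ends of a vertical edge are related by sliding the edge west, one square at a
    time; these squares belong to the staircase, because they lie in the row of
    the edge and to its west. *)
Lemma home_along n d :
  d \in sE (staircase n) -> comb_along (staircase n) (pt 0 0) home d.
Proof.
have subS := staircase_subcomplex n.
have orient (d1 : dart Q) : (d1 \in sE (staircase n) ->
    comb_along (staircase n) (pt 0 0) home d1) ->
    dinv d1 \in sE (staircase n) -> comb_along (staircase n) (pt 0 0) home (dinv d1).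
  case: (subS) => dS _ _ along d1S; have d1S' : d1 \in sE (staircase n).
    by rewrite -[d1](disk_dinvK diskQ); apply: dS.
  apply: comb_along_dinv => //; [exact: home_walk | exact: along].
move: d; apply: dartW => x y o xp yq.
  have along : hd x y false \in sE (staircase n) ->
      comb_along (staircase n) (pt 0 0) home (hd x y false).
    have xp1 := leqW xp.
    move=> _; rewrite /comb_along src_hd ?tgt_hd // addn0 addn1 !homeE //.
    exact: homotopic_refl.
  by case: o => //; have := orient _ along; rewrite dinv_hd.
have along : vd x y false \in sE (staircase n) ->
    comb_along (staircase n) (pt 0 0) home (vd x y false).
  have yq1 := leqW yq.
  rewrite /comb_along src_vd ?tgt_vd // addn0 addn1 !homeE //.
  rewrite vd_in_staircase //; elim: x xp => [|x IHx] xp xy_n; first exact: homotopic_refl.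
  have cS : sq x y \in sF (staircase n) by rewrite mem_first_cells.
  have fr : face (vd x.+1 y false) = Some (sq x y) by rewrite face_vd.
  have := homotopic_square diskQ subS fr cS (orbit_right xp yq).
  rewrite src_vd // addn1 src_vd ?(ltnW xp) // addn0 => square.
  have restS : walk (staircase n) (pt x y) (west x y ++ south y) (pt 0 0).
    rewrite -homeE ?(ltnW xp) ?leqW //; apply: home_walk.
    rewrite pt_in_staircase ?(ltnW xp) ?leqW //; move: xy_n => /=.
    by case: (y) => [|y'] /=; lia.
  apply: (homotopic_trans (homotopic_catr restS square)) => /=.
  have topS : hd x y.+1 false \in sE (staircase n) by rewrite hd_in_staircase.
  have := @homotopic_cons _ _ subS (pt 0 0) _ (vd x y false :: west x y ++ south y)
    (west x y.+1 ++ south y.+1) topS.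
  rewrite src_hd // addn1 tgt_hd // addn0; apply; apply: IHx (ltnW xp) _.
  by move: xy_n => /=; lia.
by case: o => //; have := orient _ along; rewrite dinv_vd.
Qed.

Lemma origin_in_staircase n : pt 0 0 \in sV (staircase n).
Proof. by rewrite inE eqxx. Qed.

Lemma staircase_connected n : is_connected (staircase n).
Proof.
apply: (combing_connected diskQ (staircase_subcomplex n) (origin_in_staircase n)).
exact: home_walk.
Qed.

Lemma staircase_simply_connected n : simply_connected (staircase n).
Proof.
apply: (combing_simply_connected diskQ (staircase_subcomplex n) (@home_walk n)).
exact: home_along.
Qed.

Lemma origin_on_boundary n : pt 0 0 \in bd_vertices (staircase n).
Proof.
apply/setIdP; split; first exact: origin_in_staircase.
case: n => [|n]; apply/orP; [right | left].
  apply/existsPn => d; apply/nandP; left; move: d; apply: dartW => x y o xp yq.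
    by rewrite hd_in_staircase.
  by rewrite vd_in_staircase.
apply/existsP; exists (hd 0 0 true); rewrite src_hd // eqxx andbT bd_darts_hull //.
by rewrite dinv_hd !face_hd //= mem_first_cells.
Qed.

(** Of the four squares around a vertex, the one to its upper right comes last in
    the order of [first_cells]: once it is present, so are the other three. *)
Lemma cells_around n x y (e : dart Q) : 0 < x <= p -> 0 < y <= q ->
  y * p.+1 + x < n -> src e = pt x y -> cell_in (first_cells n) (face e).
Proof.
move=> /andP[x0 xp] /andP[y0 yq] xy_n; have xp1 := leqW xp; have yq1 := leqW yq.
move: e; apply: dartW => x' y' o xp' yq'; rewrite ?src_hd ?src_vd // => /eqP;
  rewrite pt_eq //; try by case: (o); lia.
  case/andP=> /eqP xE /eqP yE; rewrite face_hd // yE y0 yq.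
  by case: (o) xE => /= xE; rewrite mem_first_cells //; nia.
case/andP=> /eqP xE /eqP yE; rewrite face_vd // xE x0 xp.
by case: (o) yE => /= yE; rewrite mem_first_cells //; nia.
Qed.

(** In every case at least two sides are free, and as many sides or fewer replace
    them on the boundary. *)
Lemma staircase_cell_step n : n < p.+1 * q.+1 ->
  cell_step (pt 0 0) (staircase n.+1) (staircase n) /\
  bd_length (staircase n) <= bd_length (staircase n.+1).
Proof.
move=> n_lt; pose x := n %% p.+1; pose y := n %/ p.+1.
have nE : n = y * p.+1 + x by apply: divn_eq.
have xp : x <= p by rewrite -ltnS ltn_mod.
have yq : y <= q by rewrite -ltnS ltn_divLR // mulnC.
have cE : first_cells n = first_cells n.+1 :\ sq x y.
  apply/setP; apply: sqW => x' y' xp' yq'.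
  rewrite !in_setD1 !mem_first_cells // sq_eq //.
  have [->|y_neq] /= := eqVneq y' y; first by rewrite andbT; lia.
  rewrite andbF /= nE; case: (ltngtP y' y) y_neq => // y_lt _; nia.
have cF : sq x y \in first_cells n.+1 by rewrite mem_first_cells // -nE.
have top_free : ~~ cell_in (first_cells n.+1) (face (dinv (hd x y.+1 true))).
  by rewrite dinv_hd face_hd //=; case: ifP => //= yq'; rewrite mem_first_cells //; lia.
have right_free : ~~ cell_in (first_cells n.+1) (face (dinv (vd x.+1 y false))).
  by rewrite dinv_vd face_vd //=; case: ifP => //= xp'; rewrite mem_first_cells //; lia.
have bottomE : cell_in (first_cells n.+1 :\ sq x y) (face (dinv (hd x y false))) = (0 < y).
  rewrite -cE dinv_hd face_hd ?leqW //=; case: ifP => //= y0.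
  by rewrite mem_first_cells //; nia.
have leftE : cell_in (first_cells n.+1 :\ sq x y) (face (dinv (vd x y true))) = (0 < x).
  rewrite -cE dinv_vd face_vd ?leqW //=; case: ifP => //= x0.
  by rewrite mem_first_cells //; lia.
have bottom_free : y = 0 -> ~~ cell_in (first_cells n.+1) (face (dinv (hd x y false))).
  by move=> y0; rewrite dinv_hd face_hd ?leqW //= y0.
have left_free : x = 0 -> ~~ cell_in (first_cells n.+1) (face (dinv (vd x y true))).
  by move=> x0; rewrite dinv_vd face_vd ?leqW //= x0.
have nondeg (e : dart Q) : face e != None -> (nxt e != e) && (nxt e != dinv e).
  move: e; apply: dartW => x' y' [] xp' yq'; rewrite ?face_hd ?face_vd //.
  - by case: ifP => // y0 _; rewrite nxt_east // y0.
  - by case: ifP => // y0 _; rewrite nxt_west // y0.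
  - by case: ifP => // y0 _; rewrite nxt_north // y0.
  - by case: ifP => // y0 _; rewrite nxt_south // y0.
rewrite /staircase cE.
suff [d [k [[fd k_gt0] Afree Bcov Binn sizes]]] : exists d k,
  [/\ face d = Some (sq x y) /\ 0 < k,
   forall e, e \in take k (orbit (@nxt Q) d) -> ~~ cell_in (first_cells n.+1) (face (dinv e)),
   forall e, e \in drop k (orbit (@nxt Q) d) ->
     cell_in (first_cells n.+1 :\ sq x y) (face (dinv e)),
   forall e, e \in behead (drop k (orbit (@nxt Q) d)) ->
     forall e', src e' = src e -> cell_in (first_cells n.+1) (face e')
   & size (drop k (orbit (@nxt Q) d)) <= size (take k (orbit (@nxt Q) d))].
  split; first exact: (hull_cell_step diskQ _ cF fd Afree Bcov k_gt0 Binn nondeg).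
  rewrite -(leq_add2r (size (take k (orbit (@nxt Q) d)))).
  by apply: leq_trans (bd_length_hull_step diskQ (pt 0 0) cF fd Afree) _; rewrite leq_add2l.
have ftop : face (hd x y.+1 true) = Some (sq x y) by rewrite face_hd.
have fleft : face (vd x y true) = Some (sq x y) by rewrite face_vd ?leqW // xp.
have [x0|x_gt0] := posnP x; have [y0|y_gt0] := posnP y.
(* The free sides are the top and the right one, also the left one in the first
   column and the bottom one in the bottom row. The arc is read clockwise, from
   its first free side. *)
- exists (hd x y.+1 true), 4; rewrite orbit_top //=; split=> // e.
  by rewrite !inE => /or4P[] /eqP-> //; [apply: bottom_free | apply: left_free].
- exists (vd x y true), 3; rewrite orbit_left //=; split=> // e; rewrite !inE.
    by case/or3P=> /eqP-> //; apply: left_free.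
  by move/eqP=> ->; rewrite bottomE.
- exists (hd x y.+1 true), 3; rewrite orbit_top //=; split=> // e; rewrite !inE.
    by case/or3P=> /eqP-> //; apply: bottom_free.
  by move/eqP=> ->; rewrite leftE.
have inner (e' : dart Q) : src e' = pt x y -> cell_in (first_cells n.+1) (face e').
  by apply: cells_around; rewrite ?x_gt0 ?y_gt0 // -nE.
have src_left : src (vd x y true) = pt x y by rewrite src_vd ?leqW // addn0.
exists (hd x y.+1 true), 2; rewrite orbit_top //=; split=> // e; rewrite !inE.
- by case/orP=> /eqP->.
- by case/orP=> /eqP->; rewrite ?bottomE ?leftE.
by move/eqP=> -> e' se'; apply: inner; rewrite -src_left.
Qed.

Lemma staircase0 : staircase 0 = single_vertex (pt 0 0 : vertex Q).
Proof.
have E0 : sE (staircase 0) = set0.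
  apply/setP; apply: dartW => x y o xp yq; rewrite in_set0.
    by rewrite hd_in_staircase.
  by rewrite vd_in_staircase.
have F0 : sF (staircase 0) = set0 by apply/setP => c; rewrite !inE.
have V0 : sV (staircase 0) = [set pt 0 0].
  apply/setP => v; rewrite !inE; case: eqP => //= _.
  by apply/existsPn => d; rewrite -[hull_darts _]/(sE (staircase 0)) E0 in_set0.
by rewrite /single_vertex -E0 -V0 -F0.
Qed.

Lemma staircase_full : staircase (p.+1 * q.+1) = full Q.
Proof.
have EF : sE (staircase (p.+1 * q.+1)) = setT.
  apply/setP; apply: dartW => x y o xp yq; rewrite in_setT.
    rewrite hd_in_staircase //; nia.
  rewrite vd_in_staircase //; nia.
have FF : sF (staircase (p.+1 * q.+1)) = setT.
  apply/setP; apply: sqW => x y xp yq; rewrite in_setT mem_first_cells //; nia.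
have VF : sV (staircase (p.+1 * q.+1)) = setT.
  apply/setP; apply: ptW => x y xp yq; rewrite in_setT pt_in_staircase //; nia.
by rewrite /full -EF -VF -FF.
Qed.

Lemma bd_full d : (d \in bd_darts (full Q)) = (face d == None).
Proof. by rewrite !inE /=; case: (gface d) => [c|]; rewrite ?inE. Qed.

Lemma bd_length_full : bd_length (full Q) = 2 * (p.+1 + q.+1).
Proof.
transitivity #|[set d in outer_sides p q]|.
  by apply: eq_card => d; rewrite inE bd_full mem_outer_sides.
rewrite cardsE (card_uniqP (outer_sides_uniq p q)) !size_cat !size_mkseq; lia.
Qed.

(** Lemma [staircase_cell_step] removes the squares from the last one down to the
    first, whose removal leaves the origin alone. *)
Lemma staircase_shelling : exists N (Sigma : nat -> subcomplex Q),
  based_shelling (pt 0 0) N Sigma /\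
  forall j, j <= N -> bd_length (Sigma j) <= 2 * (p.+1 + q.+1).
Proof.
set N := p.+1 * q.+1; exists N, (fun j => staircase (N - j)); split.
  split; rewrite ?subn0 ?subnn.
  - exact: staircase_full.
  - exact: staircase0.
  - move=> j _; split; first exact: staircase_subcomplex.
    + exact: staircase_connected.
    + exact: staircase_simply_connected.
    + exact: origin_on_boundary.
  move=> j j_lt; right; have [|+ _] := @staircase_cell_step (N - j.+1); first lia.
  by rewrite (_ : (N - j.+1).+1 = N - j) //; lia.
elim=> [|j IHj] j_le; first by rewrite subn0 staircase_full bd_length_full.
apply: leq_trans (IHj (ltnW j_le)).
have [|_ +] := @staircase_cell_step (N - j.+1); first lia.
by rewrite (_ : (N - j.+1).+1 = N - j) //; lia.
Qed.

End Staircase.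

(** * A quarter turn of the grid *)

Section QuarterTurn.
Variables p q : nat.
Notation Q := (grid p.+1 q.+1).
Notation Q' := (grid q.+1 p.+1).

(** The turn is counterclockwise: an edge pointing north becomes one pointing
    west, whence the change of orientation of vertical edges. *)
Definition turn_v (u : vertex Q) : vertex Q' := (rev_ord u.2, u.1).
Definition turn_c (c : cell Q) : cell Q' := (rev_ord c.2, c.1).
Definition turn_d (d : dart Q) : dart Q' :=
  match d with
  | (inl (x, y), o) => (inr (rev_ord y, x), o)
  | (inr (x, y), o) => (inl (rev_ord y, x), ~~ o)
  end.

Arguments turn_c : simpl never.

Lemma turn_v_bij : bijective turn_v.
Proof.
exists (fun u : vertex Q' => (u.2, rev_ord u.1) : vertex Q) => -[x y];
by rewrite /turn_v /= rev_ordK.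
Qed.

Lemma turn_c_bij : bijective turn_c.
Proof.
exists (fun c : cell Q' => (c.2, rev_ord c.1) : cell Q) => -[x y];
by rewrite /turn_c /= rev_ordK.
Qed.

Lemma turn_d_bij : bijective turn_d.
Proof.
exists (fun d : dart Q' => match d with
  | (inl (x, y), o) => (inr (y, rev_ord x), ~~ o)
  | (inr (x, y), o) => (inl (y, rev_ord x), o) end : dart Q) => -[[[x y]|[x y]] o];
by rewrite /= ?rev_ordK ?negbK.
Qed.

Lemma rev_inord n i : i <= n -> rev_ord (inord i : 'I_n.+1) = inord (n - i).
Proof. by move=> i_n; apply: val_inj; rewrite /= !inordK ?subSS // ltnS leq_subr. Qed.

Lemma turn_pt x y : y <= q.+1 -> turn_v (pt p q x y) = pt q p (q.+1 - y) x.
Proof. by move=> yq; rewrite /turn_v rev_inord. Qed.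

Lemma turn_sq x y : y <= q -> turn_c (sq p q x y) = sq q p (q - y) x.
Proof. by move=> yq; rewrite /turn_c rev_inord. Qed.

Lemma turn_hd x y o : y <= q.+1 -> turn_d (hd p q x y o) = vd q p (q.+1 - y) x o.
Proof. by move=> yq; rewrite /= rev_inord. Qed.

Lemma turn_vd x y o : y <= q -> turn_d (vd p q x y o) = hd q p (q - y) x (~~ o).
Proof. by move=> yq; rewrite /= rev_inord. Qed.

Lemma turn_src d : src (turn_d d) = turn_v (src d).
Proof.
move: d; apply: dartW => x y o xp yq.
  rewrite turn_hd // src_vd ?leq_subr // src_hd //.
  by rewrite turn_pt.
rewrite turn_vd // src_hd ?leq_subr // src_vd // turn_pt; last by case: (o); lia.
by congr pt; case: (o); rewrite /=; lia.
Qed.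

Lemma turn_dinv d : dinv (turn_d d) = turn_d (dinv d).
Proof. by case: d => [[[x y]|[x y]] o]. Qed.

Lemma turn_face d : face (turn_d d) = omap turn_c (face d).
Proof.
move: d; apply: dartW => x y o xp yq.
  rewrite turn_hd // face_vd ?leq_subr // face_hd //.
  by case: o => /=; case: ifP => cond; case: ifP => cond' //=; try lia;
    rewrite turn_sq; try lia; congr (Some (sq _ _ _ _)); lia.
rewrite turn_vd // face_hd ?leq_subr // face_vd //.
by case: o => /=; case: ifP => cond //=; rewrite turn_sq.
Qed.

Lemma turn_nxt d : nxt (turn_d d) = turn_d (nxt d).
Proof.
move: d; apply: dartW => x y [] xp yq.
- rewrite turn_hd // nxt_north ?leq_subr // nxt_east //.
  by do ?[case: ifP => ?]; try lia; rewrite ?turn_vd ?turn_hd //; try lia;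
    (congr hd || congr vd); lia.
- rewrite turn_hd // nxt_south ?leq_subr // nxt_west //.
  by do ?[case: ifP => ?]; try lia; rewrite ?turn_vd ?turn_hd //; try lia;
    (congr hd || congr vd); lia.
- rewrite turn_vd // nxt_west ?leq_subr // nxt_north //.
  by do ?[case: ifP => ?]; try lia; rewrite ?turn_vd ?turn_hd //; try lia;
    (congr hd || congr vd); lia.
- rewrite turn_vd // nxt_east ?leq_subr // nxt_south //.
  by do ?[case: ifP => ?]; try lia; rewrite ?turn_vd ?turn_hd //; try lia;
    (congr hd || congr vd); lia.
Qed.

Definition quarter_turn : complex_iso Q Q' :=
  ComplexIso turn_v_bij turn_d_bij turn_c_bij turn_src turn_dinv turn_nxt turn_face.

End QuarterTurn.

(** * The filling length of the grid *)

Section FillingLength.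

Definition shellable_from p q (b : vertex (grid p.+1 q.+1)) :=
  exists N (Sigma : nat -> subcomplex (grid p.+1 q.+1)),
    based_shelling b N Sigma /\
    forall j, j <= N -> bd_length (Sigma j) <= 2 * (p.+1 + q.+1).

(** Turning swaps [p] and [q] and moves the lower left corner to the lower right
    one; since the side lengths are arbitrary, iterating reaches all corners. *)
Lemma shellable_turn p q b :
  @shellable_from p q b -> @shellable_from q p (turn_v b).
Proof.
case=> N [Sigma [shell short]]; exists N, (iso_sub (quarter_turn p q) \o Sigma).
split; first exact: (iso_shelling (quarter_turn p q) (grid_disk p q) shell).
by move=> j j_le; rewrite /= iso_bd_length [q.+1 + _]addnC; apply: short.
Qed.

Lemma shellable_from_corner p q (v : vertex (grid p.+1 q.+1)) :
  grid_corner v -> shellable_from v.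
Proof.
have at00 m n : @shellable_from m n (pt m n 0 0) := staircase_shelling m n.
have at10 m n : @shellable_from m n (pt m n m.+1 0).
  by have := shellable_turn (at00 n m); rewrite turn_pt.
have at11 m n : @shellable_from m n (pt m n m.+1 n.+1).
  by have := shellable_turn (at10 n m); rewrite turn_pt.
have at01 m n : @shellable_from m n (pt m n 0 n.+1).
  by have := shellable_turn (at11 n m); rewrite turn_pt // subnn.
have pt0 n : ord0 = inord 0 :> 'I_n.+1 by apply: val_inj; rewrite /= inordK.
have ptM n : ord_max = inord n :> 'I_n.+1 by apply: val_inj; rewrite /= inordK.
case: v => x y /andP[/= /orP[]/eqP-> /orP[]/eqP->]; rewrite ?pt0 ?ptM.
- exact: at00.
- exact: at01.
- exact: at10.
- exact: at11.
Qed.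

Local Open Scope ring_scope.

(** Every shelling starts with the boundary of the whole grid, and some shelling
    never exceeds it. *)
Lemma FL_grid (R : realType) p q (v : vertex (grid p.+1 q.+1)) :
  grid_corner v -> FL R v = (2 * (p.+1 + q.+1))%:R.
Proof.
move=> vcorner; rewrite /FL; set E := (X in inf X).
have lbE : classical_sets.lbound E (2 * (p.+1 + q.+1))%:R.
  move=> _ [N [Sigma [[S0 _ _ _] ->]]]; rewrite ler_nat -bd_length_full -S0.
  exact: (leq_bigmax (ord0 : 'I_N.+1)).
have inE : E (2 * (p.+1 + q.+1))%:R.
  have [N [Sigma [shell short]]] := shellable_from_corner vcorner.
  exists N, Sigma; split=> //; congr _%:R; apply/eqP; rewrite eqn_leq.
  apply/andP; split; last by apply/bigmax_leqP => j _; apply: short; rewrite -ltnS.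
  rewrite -bd_length_full; case: shell => <- _ _ _.
  exact: (leq_bigmax (ord0 : 'I_N.+1)).
apply/le_anti/andP; split; last by apply: lb_le_inf; first exists (2 * (p.+1 + q.+1))%:R.
by apply: ge_inf => //; exists (2 * (p.+1 + q.+1))%:R.
Qed.

End FillingLength.

(** * The first Dirichlet eigenvalue of the grid *)

Section DirichletPath.
Local Open Scope ring_scope.
Variables (R : realType) (n : nat).

(** The ground state of the path with [n.+1] edges and Dirichlet ends. *)
Definition path_sine (x : nat) : R := sin (pi / n.+1%:R * x%:R).

Let c : R := cos (pi / n.+1%:R).

Lemma path_sine0 : path_sine 0 = 0.
Proof. by rewrite /path_sine mulr0 sin0. Qed.

Lemma path_sine_end : path_sine n.+1 = 0.
Proof. by rewrite /path_sine divfK ?sinpi // pnatr_eq0. Qed.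

Lemma path_sine_gt0 x : (0 < x < n.+1)%N -> 0 < path_sine x.
Proof.
move=> /andP[x0 xn]; apply: sin_gt0_pi; apply/andP; split.
  by rewrite mulr_gt0 ?divr_gt0 ?pi_gt0 ?ltr0n.
by rewrite -mulrA gtr_pMr ?pi_gt0 // mulrC ltr_pdivrMr ?ltr0n // mul1r ltr_nat.
Qed.

Lemma path_sine_step x : path_sine x.+2 + path_sine x = 2 * c * path_sine x.+1.
Proof.
rewrite /path_sine /c; set t := pi / _.
have -> : t * x.+2%:R = t * x.+1%:R + t by rewrite -[x.+2%:R]natr1; ring.
have -> : t * x%:R = t * x.+1%:R - t by rewrite -[x.+1%:R]natr1; ring.
by rewrite sinD sinB; ring.
Qed.

(** The defect in the inequality of the means applied to [2 f x f x.+1], with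
    weights given by the ground state. Where the ground state vanishes, at the
    two ends, the convention [_ / 0 = 0] gives the value needed below. *)
Definition jacobi_defect (f : nat -> R) (x : nat) : R :=
  path_sine x.+1 / path_sine x * f x ^+ 2 + path_sine x / path_sine x.+1 * f x.+1 ^+ 2
  - 2 * f x * f x.+1.

(** Summing the weighted squares by vertices instead of edges, the weights at an
    interior vertex add up to [2 c] by the eigenvalue equation. *)
Lemma jacobi_identity (f : nat -> R) : f 0 = 0 -> f n.+1 = 0 ->
  \sum_(x < n.+1) (f x.+1 - f x) ^+ 2 =
    2 * (1 - c) * (\sum_(x < n.+2) f x ^+ 2) + \sum_(x < n.+1) jacobi_defect f x.
Proof.
move=> f0 fn.
have sumL (a : nat -> R) :
    \sum_(x < n.+1) a x * f x ^+ 2 = \sum_(x < n.+2) a x * f x ^+ 2.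
  by rewrite [RHS]big_ord_recr /= fn expr0n mulr0 addr0.
have sumR (a : nat -> R) :
    \sum_(x < n.+1) a x * f x.+1 ^+ 2 = \sum_(x < n.+2) a x.-1 * f x ^+ 2.
  by rewrite [RHS]big_ord_recl /= f0 expr0n mulr0 add0r.
have eigen : 2 * c * (\sum_(x < n.+2) f x ^+ 2) =
    \sum_(x < n.+1) path_sine x.+1 / path_sine x * f x ^+ 2 +
    \sum_(x < n.+1) path_sine x / path_sine x.+1 * f x.+1 ^+ 2.
  rewrite (sumL (fun x => path_sine x.+1 / path_sine x)).
  rewrite (sumR (fun x => path_sine x / path_sine x.+1)).
  rewrite -big_split mulr_sumr; apply: eq_bigr => -[[|x] x_lt] _ /=.
    by rewrite f0 expr0n /= !mulr0 addr0.
  have [->|x_neq] := eqVneq x n; first by rewrite fn expr0n /= !mulr0 addr0.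
  rewrite -mulrDl -mulrDl path_sine_step mulfK //.
  by rewrite lt0r_neq0 // path_sine_gt0 //=; lia.
have squares : \sum_(x < n.+1) (f x.+1 - f x) ^+ 2 =
    2 * (\sum_(x < n.+2) f x ^+ 2) - \sum_(x < n.+1) 2 * f x * f x.+1.
  have one (a : nat -> R) : \sum_(x < n.+1) a x = \sum_(x < n.+1) 1 * a x.
    by apply: eq_bigr => x _; rewrite mul1r.
  transitivity (\sum_(x < n.+1) (f x ^+ 2) + \sum_(x < n.+1) (f x.+1 ^+ 2) -
      \sum_(x < n.+1) 2 * f x * f x.+1).
    by rewrite -big_split -sumrB; apply: eq_bigr => x _ /=; ring.
  rewrite (one (fun x => f x ^+ 2)) (sumL (fun=> 1)).
  rewrite (one (fun x => f x.+1 ^+ 2)) (sumR (fun=> 1)).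
  by rewrite -mulr_sumr; ring.
rewrite squares /jacobi_defect sumrB big_split /= -eigen; ring.
Qed.

Lemma jacobi_defect_ge0 (f : nat -> R) x : f 0 = 0 -> f n.+1 = 0 -> (x < n.+1)%N ->
  0 <= jacobi_defect f x.
Proof.
rewrite /jacobi_defect => f0 fn x_lt.
have [x0|x_gt0] := posnP x; first by rewrite x0 f0 path_sine0; lra.
have [xn|x_neq] := eqVneq x n; first by rewrite xn fn path_sine_end; lra.
have s1 : 0 < path_sine x by apply: path_sine_gt0; lia.
have s2 : 0 < path_sine x.+1 by apply: path_sine_gt0; lia.
set s := path_sine x in s1 *; set t := path_sine x.+1 in s2 *.
have -> : t / s * f x ^+ 2 + s / t * f x.+1 ^+ 2 - 2 * f x * f x.+1 =
    (t * f x - s * f x.+1) ^+ 2 / (s * t) by field; rewrite !lt0r_neq0.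
by rewrite divr_ge0 ?sqr_ge0 // mulr_ge0 // ltW.
Qed.

Lemma jacobi_defect_sine x : jacobi_defect path_sine x = 0.
Proof.
rewrite /jacobi_defect; set s := path_sine x; set t := path_sine x.+1.
have [->|s0] := eqVneq s 0; first by ring.
have [->|t0] := eqVneq t 0; first by ring.
by field; rewrite s0 t0.
Qed.

Lemma path_energy_ge (f : nat -> R) : f 0 = 0 -> f n.+1 = 0 ->
  2 * (1 - c) * (\sum_(x < n.+2) f x ^+ 2) <= \sum_(x < n.+1) (f x.+1 - f x) ^+ 2.
Proof.
move=> f0 fn; rewrite jacobi_identity // lerDl; apply: sumr_ge0 => x _.
exact: jacobi_defect_ge0.
Qed.

Lemma path_energy_sine :
  \sum_(x < n.+1) (path_sine x.+1 - path_sine x) ^+ 2 =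
    2 * (1 - c) * (\sum_(x < n.+2) path_sine x ^+ 2).
Proof.
rewrite jacobi_identity ?path_sine0 ?path_sine_end // [X in _ + X]big1 ?addr0 //.
by move=> x _; apply: jacobi_defect_sine.
Qed.

End DirichletPath.

Section GridSpectrum.
Variables p q : nat.
Notation Q := (grid p.+1 q.+1).
Let diskQ := grid_disk p q.

Lemma star_pt x y : x <= p.+1 -> y <= q.+1 -> star (pt p q x y) =
  (if x <= p then [:: hd p q x y true] else [::]) ++
  (if y <= q then [:: vd p q x y true] else [::]) ++
  (if 0 < x then [:: hd p q x.-1 y false] else [::]) ++
  (if 0 < y then [:: vd p q x y.-1 false] else [::]).
Proof.
move=> xp yq; rewrite /star /= !gout_pt //=.
by case: (x <= p); case: (y <= q); case: (0 < x); case: (0 < y).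
Qed.

Lemma degree_star (u : vertex Q) : degree u = size (star u).
Proof.
rewrite -(card_uniqP (star_uniq u)); apply: eq_card => d.
by rewrite inE mem_star.
Qed.

Definition interior x y := (0 < x <= p) && (0 < y <= q).

Lemma degree_interior x y : interior x y -> degree (pt p q x y) = 4.
Proof.
move=> /andP[/andP[x0 xp] /andP[y0 yq]].
by rewrite degree_star star_pt ?leqW // x0 xp y0 yq.
Qed.

Lemma bd_vertices_full x y : x <= p.+1 -> y <= q.+1 ->
  (pt p q x y \in bd_vertices (full Q)) = ~~ interior x y.
Proof.
move=> xp yq; set u := pt p q x y.
transitivity (has (fun d => face d == None) (star u)).
  apply/setIdP/hasP => [[_ /orP[/existsP[d /andP[]]|/existsP[]]]|[d du dN]].
  - by rewrite bd_full => dN du; exists d; rewrite ?mem_star.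
  - have [d du] : exists d, d \in star u.
      rewrite /u star_pt //; case: (leqP x p) => [xp'|xp'].
        by exists (hd p q x y true); rewrite inE eqxx.
      exists (hd p q x.-1 y false); rewrite !mem_cat (leq_ltn_trans _ xp') //.
      by rewrite mem_head !orbT.
    by exists d; rewrite inE -mem_star.
  split; first by rewrite inE.
  by apply/orP; left; apply/existsP; exists d; rewrite bd_full dN -mem_star.
rewrite /u star_pt // !has_cat.
have has_if (b : bool) (d : dart Q) :
    has (fun d => face d == None) (if b then [:: d] else [::]) = b && (face d == None).
  by case: b; rewrite //= orbF.
rewrite !has_if.
have -> : (x <= p) && (face (hd p q x y true) == None) = (x <= p) && (y == 0).
  by case: (leqP x p) => // xp'; rewrite face_hd //; case: (posnP y) => // ->.
have -> : (y <= q) && (face (vd p q x y true) == None) = (y <= q) && (p < x).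
  by case: (leqP y q) => // yq'; rewrite face_vd //; case: leqP.
have -> : (0 < x) && (face (hd p q x.-1 y false) == None) = (0 < x) && (q < y).
  by case: (posnP x) => // x0; rewrite face_hd //; [case: (leqP y q) | lia].
have -> : (0 < y) && (face (vd p q x y.-1 false) == None) = (0 < y) && (x == 0).
  by case: (posnP y) => // y0; rewrite face_vd //; [case: (posnP x) => // -> | lia].
rewrite /interior; lia.
Qed.

Local Open Scope ring_scope.
Variable R : realType.

Lemma sum_grid_darts (F : dart Q -> R) : \sum_d F d =
  \sum_(y < q.+2) \sum_(x < p.+1) \sum_o F (hd p q x y o) +
  \sum_(x < p.+2) \sum_(y < q.+1) \sum_o F (vd p q x y o).
Proof.
transitivity (\sum_(e : gedge p.+1 q.+1) \sum_o F (e, o)).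
  by rewrite pair_bigA; apply: eq_bigr => -[].
rewrite big_sumType /=; congr (_ + _).
  rewrite [RHS]exchange_big [RHS]pair_bigA /=; apply: eq_bigr => -[x y] _ /=.
  by rewrite /hd !inord_val.
rewrite [RHS]pair_bigA /=; apply: eq_bigr => -[x y] _ /=.
by rewrite /vd !inord_val.
Qed.

Lemma sum_grid_vertices (F : vertex Q -> R) :
  \sum_u F u = \sum_(y < q.+2) \sum_(x < p.+2) F (pt p q x y).
Proof.
rewrite exchange_big [RHS]pair_bigA /=; apply: eq_bigr => -[x y] _ /=.
by rewrite /pt !inord_val.
Qed.

Section Function.
Variable f : vertex Q -> R.
Hypothesis f_bd : forall v, v \in bd_vertices (full Q) -> f v = 0.

Let g x y := f (pt p q x y).

(** The sum over darts counts every edge twice; the edges are sorted into rows and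
    columns, each a path. *)
Lemma grid_energy :
  2^-1 * \sum_(d : dart Q) (f (tgt d) - f (src d)) ^+ 2 =
  \sum_(y < q.+2) \sum_(x < p.+1) (g x.+1 y - g x y) ^+ 2 +
  \sum_(x < p.+2) \sum_(y < q.+1) (g x y.+1 - g x y) ^+ 2.
Proof.
rewrite sum_grid_darts mulrDr !mulr_sumr; congr (_ + _); apply: eq_bigr => i _;
  rewrite mulr_sumr; apply: eq_bigr => j _; rewrite big_bool.
  have [jp iq] : (j <= p /\ i <= q.+1)%N by split; rewrite -ltnS.
  by rewrite !tgt_hd // !src_hd // !addn0 !addn1 /g /=; field.
have [ip jq] : (i <= p.+1 /\ j <= q)%N by split; rewrite -ltnS.
by rewrite !tgt_vd // !src_vd // !addn0 !addn1 /g /=; field.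
Qed.

Lemma grid_mass :
  \sum_(v | v \notin bd_vertices (full Q)) (degree v)%:R * f v ^+ 2 =
  4 * \sum_(y < q.+2) \sum_(x < p.+2) g x y ^+ 2.
Proof.
rewrite -(sum_grid_vertices (fun v => f v ^+ 2)) mulr_sumr big_mkcond.
apply: eq_bigr; apply: (@ptW p q) => x y xp yq _.
case: ifPn => [|/negPn/f_bd ->]; last by rewrite expr0n mulr0.
by rewrite bd_vertices_full // negbK => /degree_interior ->.
Qed.

Lemma grid_energy_ge :
  (2 * (1 - cos (pi / p.+1%:R)) + 2 * (1 - cos (pi / q.+1%:R))) *
    (\sum_(y < q.+2) \sum_(x < p.+2) g x y ^+ 2) <=
  2^-1 * \sum_(d : dart Q) (f (tgt d) - f (src d)) ^+ 2.
Proof.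
have g_bd x y : (x <= p.+1)%N -> (y <= q.+1)%N -> ~~ interior x y -> g x y = 0.
  by move=> xp yq xy; apply: f_bd; rewrite bd_vertices_full.
rewrite grid_energy mulrDl; apply: lerD; last rewrite exchange_big /=.
  rewrite mulr_sumr; apply: ler_sum => y _.
  by apply: (path_energy_ge (f := fun x => g x y)); apply: g_bd;
    rewrite /interior ?ltnn ?andbF // -ltnS.
rewrite mulr_sumr; apply: ler_sum => x _.
by apply: (path_energy_ge (f := fun y => g x y)); apply: g_bd;
  rewrite /interior ?ltnn ?andbF // -ltnS.
Qed.

Lemma grid_mass_gt0 : (exists v, f v != 0) ->
  0 < \sum_(y < q.+2) \sum_(x < p.+2) g x y ^+ 2.
Proof.
case=> v fv; rewrite -(sum_grid_vertices (fun v => f v ^+ 2)).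
rewrite (bigD1 v) //= ltr_pwDl ?exprn_even_gt0 //.
by apply: sumr_ge0 => u _; apply: sqr_ge0.
Qed.

End Function.

Definition grid_sine (v : vertex Q) : R := path_sine R p v.1 * path_sine R q v.2.

Lemma grid_sine_pt x y : (x <= p.+1)%N -> (y <= q.+1)%N ->
  grid_sine (pt p q x y) = path_sine R p x * path_sine R q y.
Proof. by move=> xp yq; rewrite /grid_sine /= !inordK. Qed.

Lemma grid_sine_bd v : v \in bd_vertices (full Q) -> grid_sine v = 0.
Proof.
move: v; apply: ptW => x y xp yq; rewrite bd_vertices_full // grid_sine_pt //.
have ends n z : (z <= n.+1)%N -> ~~ (0 < z <= n)%N -> path_sine R n z = 0.
  move=> zn z_end; have [->|->] : z = 0%N \/ z = n.+1 by lia.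
    exact: path_sine0.
  exact: path_sine_end.
by rewrite /interior negb_and => /orP[] /ends-> //; rewrite ?mul0r ?mulr0.
Qed.

Lemma grid_sine_energy :
  2^-1 * \sum_(d : dart Q) (grid_sine (tgt d) - grid_sine (src d)) ^+ 2 =
  (2 * (1 - cos (pi / p.+1%:R)) + 2 * (1 - cos (pi / q.+1%:R))) *
    (\sum_(y < q.+2) \sum_(x < p.+2) grid_sine (pt p q x y) ^+ 2).
Proof.
rewrite grid_energy mulrDl; congr (_ + _); last rewrite [X in _ = _ * X]exchange_big /=.
  rewrite mulr_sumr; apply: eq_bigr => y _; have yq : (y <= q.+1)%N by rewrite -ltnS.
  transitivity (path_sine R q y ^+ 2 *
      \sum_(x < p.+1) (path_sine R p x.+1 - path_sine R p x) ^+ 2).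
    rewrite mulr_sumr; apply: eq_bigr => x _; have xp : (x <= p)%N by rewrite -ltnS.
    by rewrite !grid_sine_pt ?(leqW xp) //; ring.
  rewrite path_energy_sine mulrCA !mulr_sumr; apply: eq_bigr => x _.
  by rewrite grid_sine_pt // -1?ltnS //; ring.
rewrite mulr_sumr; apply: eq_bigr => x _; have xp : (x <= p.+1)%N by rewrite -ltnS.
transitivity (path_sine R p x ^+ 2 *
    \sum_(y < q.+1) (path_sine R q y.+1 - path_sine R q y) ^+ 2).
  rewrite mulr_sumr; apply: eq_bigr => y _; have yq : (y <= q)%N by rewrite -ltnS.
  by rewrite !grid_sine_pt ?(leqW yq) //; ring.
rewrite path_energy_sine mulrCA !mulr_sumr; apply: eq_bigr => y _.
by rewrite grid_sine_pt // -1?ltnS //; ring.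
Qed.

(** The lower bound on the Rayleigh quotient is attained at the product of the two
    ground states, which is nonzero because both sides have length at least two. *)
Lemma lambda1_grid : (0 < p)%N -> (0 < q)%N ->
  lambda1 R Q = 1 - 2^-1 * (cos (pi / p.+1%:R) + cos (pi / q.+1%:R)).
Proof.
move=> p0 q0; rewrite /lambda1; set E := (X in inf X); set l := (RHS).
have ratio (M : R) : 0 < M -> l =
    (2 * (1 - cos (pi / p.+1%:R)) + 2 * (1 - cos (pi / q.+1%:R))) * M / (4 * M).
  by move=> M0; rewrite /l; field; rewrite lt0r_neq0.
have lbE : classical_sets.lbound E l.
  move=> _ [f [f_bd f_neq ->]]; have M0 := grid_mass_gt0 f_neq.
  rewrite /rayleigh grid_mass // (ratio _ M0) ler_pM2r ?invr_gt0 ?mulr_gt0 //.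
  exact: grid_energy_ge.
have lE : E l.
  exists grid_sine; split; first exact: grid_sine_bd.
    exists (pt p q 1 1); rewrite grid_sine_pt // mulf_neq0 // lt0r_neq0 //;
    exact: path_sine_gt0.
  rewrite /rayleigh grid_mass; last exact: grid_sine_bd.
  by rewrite grid_sine_energy; apply: ratio; apply: grid_mass_gt0; exists (pt p q 1 1);
    rewrite grid_sine_pt // mulf_neq0 // lt0r_neq0 //; exact: path_sine_gt0.
by apply/le_anti/andP; split; [apply: ge_inf => //; exists l | apply: lb_le_inf => //; exists l].
Qed.

End GridSpectrum.

(** * Asymptotics *)

Section CosineBounds.
Local Open Scope ring_scope.
Variable R : realType.

Lemma sin_mean_value (u : R) : 0 <= u ->
  exists2 z, 0 <= z <= u & sin u = cos z * u.
Proof.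
move=> u0; have [|z z_in] := MVT_segment u0 (fun x _ => is_derive_sin x).
  exact/continuous_subspaceT/continuous_sin.
by rewrite sin0 !subr0 => ->; exists z; rewrite // -in_itv.
Qed.

Lemma one_minus_cos (t : R) : 1 - cos t = 2 * sin (t / 2) ^+ 2.
Proof.
have -> : cos t = cos ((t / 2) *+ 2) by congr cos; rewrite mulr2n; field.
by rewrite cos_mulr2n cos2sin2; ring.
Qed.

(** By the half-angle formula and the mean value theorem, [1 - cos t] is half of
    [t^2] times the square of the cosine of an angle in the first octant. *)
Lemma one_minus_cos_bounds (t : R) : 0 <= t <= pi / 2 ->
  2^-1 * cos (pi / 4) ^+ 2 * t ^+ 2 <= 1 - cos t <= 2^-1 * t ^+ 2.
Proof.
move=> /andP[t0 t_le]; rewrite one_minus_cos.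
have u0 : 0 <= t / 2 by rewrite divr_ge0.
have pi0 := pi_gt0 R.
have [z /andP[z0 zu] ->] := sin_mean_value u0.
have k_gt0 : 0 < cos (pi / 4) :> R by apply: cos_gt0_pihalf; apply/andP; split; lra.
have z_le : z <= pi / 4 by lra.
have cos_ge : cos (pi / 4) <= cos z.
  rewrite leNgt ltr_cos ?in_itv /= -?leNgt //; apply/andP; split; lra.
have cos_sqr_ge : cos (pi / 4) ^+ 2 <= cos z ^+ 2.
  by rewrite ler_pXn2r // nnegrE ?(le_trans _ cos_ge) // ltW.
have cos_sqr_le : cos z ^+ 2 <= 1.
  by rewrite expr_le1 ?cos_le1 // (le_trans _ cos_ge) // ltW.
have t2 : 0 <= t ^+ 2 by apply: sqr_ge0.
have -> : 2 * (cos z * (t / 2)) ^+ 2 = 2^-1 * cos z ^+ 2 * t ^+ 2 by field.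
rewrite -!(mulrA 2^-1) !ler_pM2l ?invr_gt0 //; apply/andP; split; first exact: ler_wpM2r.
exact: ler_piMl.
Qed.

End CosineBounds.

Section Asymptotics.
Local Open Scope ring_scope.
Variable R : realType.

Lemma lambda1_asymptotics : exists c C : R, [/\ 0 < c, 0 < C &
  forall p q : nat, (2 <= p)%N -> (2 <= q)%N ->
    c * (p%:R ^- 2 + q%:R ^- 2) <= lambda1 R (grid p q)
      <= C * (p%:R ^- 2 + q%:R ^- 2)].
Proof.
have pi0 := pi_gt0 R.
have k_gt0 : 0 < cos (pi / 4) :> R by apply: cos_gt0_pihalf; apply/andP; split; lra.
exists (4^-1 * cos (pi / 4) ^+ 2 * pi ^+ 2), (4^-1 * pi ^+ 2); split.
- by rewrite !mulr_gt0 ?exprn_gt0 ?invr_gt0.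
- by rewrite !mulr_gt0 ?exprn_gt0 ?invr_gt0.
have angle n : (2 <= n)%N -> 0 <= (pi : R) / n%:R <= pi / 2.
  move=> n2; have n0 : (0 < n)%N by apply: ltnW.
  apply/andP; split; first by rewrite divr_ge0 ?ler0n // ltW.
  by rewrite ler_pM2l // lef_pV2 ?posrE ?ltr0n // ler_nat.
move=> [|p] [|q] // p2 q2; rewrite lambda1_grid //.
have /andP[] := one_minus_cos_bounds (angle _ p2).
have /andP[] := one_minus_cos_bounds (angle _ q2).
rewrite !expr_div_n; set a := _ ^- 2; set b := _ ^- 2 => *.
by apply/andP; split; lra.
Qed.

(** Both bounds compare the square of [2 (a + b)] with the inverse of
    [a^-2 + b^-2]; each of the quantities [(a + b)^2 / a^2] and [(a + b)^2 / b^2]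
    lies between 1 and [(1 + K)^2]. *)
Lemma FL_asymptotics (K : R) : 0 < K -> exists c C : R, [/\ 0 < c, 0 < C &
  forall (p q : nat) (v : vertex (grid p q)),
    (2 <= p)%N -> (2 <= q)%N -> grid_corner v ->
    K^-1 <= p%:R / q%:R <= K ->
    c * lambda1 R (grid p q) `^ (- 2^-1) <= FL R v
      <= C * lambda1 R (grid p q) `^ (- 2^-1)].
Proof.
move=> K0; have [c [C [c0 C0 lamP]]] := lambda1_asymptotics.
exists (Num.sqrt (8 * c)), (Num.sqrt (8 * C) * (1 + K)); split.
- by rewrite sqrtr_gt0 mulr_gt0.
- by rewrite mulr_gt0 ?sqrtr_gt0 ?mulr_gt0 ?addr_gt0.
move=> [|p] [|q] // v p2 q2 vcorner /andP[ratio_ge ratio_le].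
have {lamP} /andP[lam_ge lam_le] := lamP _ _ p2 q2; rewrite FL_grid //.
set lam := lambda1 _ _ in lam_ge lam_le *.
rewrite natrM natrD; set a : R := p.+1%:R in ratio_ge ratio_le lam_ge lam_le *.
set b : R := q.+1%:R in ratio_ge ratio_le lam_ge lam_le *.
have a0 : 0 < a by rewrite ltr0n.
have b0 : 0 < b by rewrite ltr0n.
have lam0 : 0 < lam.
  by apply: lt_le_trans lam_ge; rewrite mulr_gt0 // addr_gt0 ?invr_gt0 ?exprn_gt0.
have L0 : 0 < 2 * (a + b) by rewrite mulr_gt0 ?addr_gt0.
rewrite powRN powR12_sqrt ?(ltW lam0) //.
have s0 : 0 < Num.sqrt lam by rewrite sqrtr_gt0.
rewrite ler_pdivrMr // ler_pdivlMr //.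
have sqrt_lam : Num.sqrt lam ^+ 2 = lam by rewrite sqr_sqrtr ?ltW.
have b_le : b <= K * a by rewrite ler_pdivlMr // ler_pdivrMl // in ratio_ge.
have a_le : a <= K * b by rewrite ler_pdivrMr in ratio_le.
have part x y : 0 < x -> 0 < y -> y <= K * x ->
    1 <= (x + y) ^+ 2 * x ^- 2 <= (1 + K) ^+ 2.
  move=> x0 y0 y_le; have x2 : 0 < x ^+ 2 by rewrite exprn_gt0.
  rewrite ler_pdivlMr // ler_pdivrMr // mul1r -exprMn.
  by rewrite !ler_pXn2r ?nnegrE //; try nra; lra.
have /andP[A_ge A_le] := part _ _ a0 b0 b_le.
have /andP[B_ge B_le] := part _ _ b0 a0 a_le; rewrite [b + a]addrC in B_ge B_le.
set A := a ^- 2 in A_ge A_le lam_ge lam_le *; set B := b ^- 2 in B_ge B_le lam_ge lam_le *.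
set S := (a + b) ^+ 2 in A_ge A_le B_ge B_le *.
have S0 : 0 <= S by apply: sqr_ge0.
have Ls : (2 * (a + b) * Num.sqrt lam) ^+ 2 = 4 * (S * lam).
  by rewrite !exprMn sqrt_lam /S; ring.
have Slam_ge : c * (S * (A + B)) <= S * lam by rewrite mulrCA ler_wpM2l.
have Slam_le : S * lam <= C * (S * (A + B)) by rewrite [C * _]mulrCA ler_wpM2l.
have pos_Ls : 0 <= 2 * (a + b) * Num.sqrt lam by rewrite mulr_ge0 ?ltW.
apply/andP; split.
  rewrite -(ler_pXn2r (n := 2)) ?nnegrE ?sqrtr_ge0 // Ls sqr_sqrtr; last lra.
  have : c * 2 <= c * (S * (A + B)) by rewrite ler_pM2l //; lra.
  by lra.
have pos_CK : 0 <= Num.sqrt (8 * C) * (1 + K).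
  by rewrite mulr_ge0 ?sqrtr_ge0 // addr_ge0 // ltW.
rewrite -(ler_pXn2r (n := 2)) ?nnegrE // Ls.
rewrite exprMn sqr_sqrtr; last lra.
have : C * (S * (A + B)) <= C * (2 * (1 + K) ^+ 2) by rewrite ler_pM2l //; lra.
by lra.
Qed.

End Asymptotics.

Local Open Scope ring_scope.

Theorem proposition3p14 (R : realType) :
  (forall (p q : nat) (v : vertex (grid p q)),
     (2 <= p)%N -> (2 <= q)%N -> grid_corner v ->
     [/\ area_minimising commutator_relators (grid p q),
         is_pure (grid p q),
         is_boundary_word (grid p q) (commutator_word p q) /\
         (forall w, is_boundary_word (grid p q) w -> cyclically_reduced w),
         FL R v = (2 * (p + q))%:R
       & lambda1 R (grid p q)
           = 1 - 2^-1 * (cos (pi / p%:R) + cos (pi / q%:R))])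
  /\
  (exists c C : R, [/\ 0 < c, 0 < C &
     forall p q : nat, (2 <= p)%N -> (2 <= q)%N ->
       c * (p%:R ^- 2 + q%:R ^- 2) <= lambda1 R (grid p q)
         <= C * (p%:R ^- 2 + q%:R ^- 2)])
  /\
  (forall K : R, 0 < K ->
   exists c C : R, [/\ 0 < c, 0 < C &
     forall (p q : nat) (v : vertex (grid p q)),
       (2 <= p)%N -> (2 <= q)%N -> grid_corner v ->
       K^-1 <= p%:R / q%:R <= K ->
       c * lambda1 R (grid p q) `^ (- 2^-1) <= FL R v
         <= C * lambda1 R (grid p q) `^ (- 2^-1)]).
Proof.
split; last by split; [exact: lambda1_asymptotics | exact: FL_asymptotics].
move=> [|p] [|q] // v p2 q2 vcorner; split.
- exact: grid_area_minimising.
- exact: grid_pure.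
- split; [exact: grid_boundary_word | exact: grid_boundary_reduced].
- exact: FL_grid.
- exact: lambda1_grid.
Qed.
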